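(* There exist absolute constants $0 < c_1 \leq c_2$ and $c_3 > 0$ such that the following holds. Let $A \in \mathbb{C}^{m \times n}$, let $r$ be a positive integer with $r < \min(m,n)$, and let $\varepsilon,\delta \in (0,1)$. Let $R \sim \mathrm{SJLT}(n,d,\alpha)$ with $\alpha = \Theta(\log^3(r/\delta)/\varepsilon)$ and $d = \Omega(r\log^6(r/\delta)/\varepsilon^2)$, meaning that $$c_1 \frac{\log^3(r/\delta)}{\varepsilon} \le \alpha \le c_2 \frac{\log^3(r/\delta)}{\varepsilon}, \qquad d \ge c_3 \frac{r\log^6(r/\delta)}{\varepsilon^2}.$$ Let $Y = AR$ and let $P_Y$ be the orthogonal projector onto the column space of $Y$. Then, with probability at least $1-\delta$, $$\|(I - P_Y)A\| \leq \sigma_{r+1}(A) \sqrt{1 + \frac{1}{1-\varepsilon} \max\left(\frac{e^2 n \alpha}{d},\; \log\left(\frac{2d}{\delta}\right) - \frac{n\alpha}{d}\right)} .$$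
   Context: $\|\cdot\|$ is the spectral (two-)norm, $\sigma_j(A)$ is the $j$th largest singular value of $A$, and $\log$ is the natural logarithm. The projector is $P_Y = YY^\dagger$, equivalently $P_Y = QQ^*$ where $Y = Q\Omega$ is a QR factorization whose factor $Q$ has orthonormal columns spanning the range of $Y$. Sparse Johnson--Lindenstrauss transform (SJLT): for integers $n$, $d$ and $\alpha \in \{1,\dots,d\}$, $R \sim \mathrm{SJLT}(n,d,\alpha)$ means that $R \in \mathbb{R}^{n\times d}$ is a random matrix with exactly $\alpha$ nonzero entries in each row. The nonzero entries are independent and uniform on $\{1/\sqrt{\alpha}, -1/\sqrt{\alpha}\}$, and are independent of the positions of the nonzeros. The positions of the nonzeros are drawn independently for different rows, by either of two methods (the result is for either one). Graph construction: for each row, the set of $\alpha$ nonzero positions is a uniformly random $\alpha$-element subset of $\{1,\dots,d\}$. Block construction (requires $d/\alpha$ to be an integer): each length-$d$ row is divided into $\alpha$ contiguous chunks of length $d/\alpha$, and in each chunk exactly one position, chosen uniformly at random (independently over chunks), is nonzero. *)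

(* Defs.v *)
(* MathComp + MathComp-Analysis *)
From HB Require Import structures.
From mathcomp Require Export all_boot all_order all_algebra.
From mathcomp Require Export all_classical all_reals all_analysis.
From mathcomp Require Export complex.

Set Implicit Arguments.
Unset Strict Implicit.
Unset Printing Implicit Defensive.

Import Order.TTheory GRing.Theory Num.Theory.
Import numFieldNormedType.Exports.

Local Open Scope classical_set_scope.
Local Open Scope ring_scope.
Local Open Scope sesquilinear_scope.

Section ComplexMatrices.
Context {R : realType}.

Definition vnorm2 n (x : 'cV[R[i]]_n) : R :=
  Num.sqrt (\sum_i ComplexField.Normc.normc (x i 0) ^+ 2).

Definition spectral_norm m n (A : 'M[R[i]]_(m, n)) : R :=
  sup [set vnorm2 (A *m x) | x in [set x : 'cV[R[i]]_n | vnorm2 x <= 1]].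

(* Square roots of the eigenvalues, with multiplicity, of the Hermitian matrix
   A^* A, in decreasing order. The list has length n: when m < n it ends with
   at least n - m zeros. *)
Definition singular_values m n (A : 'M[R[i]]_(m, n)) : seq R :=
  sort >=%R
    [seq Num.sqrt (complex.Re (spectral_diag (A ^t* *m A) 0 i)) | i : 'I_n].

(* 1-based: sigma A 1 is the largest singular value. *)
Definition sigma m n (A : 'M[R[i]]_(m, n)) (j : nat) : R :=
  nth 0 (singular_values A) j.-1.

(* proj_ortho U acts on row vectors, as u |-> u *m proj_ortho U, and projects
   onto the row space of U; the transpositions give the orthogonal projector
   onto the column space of Y acting on column vectors. *)
Definition col_proj m d (Y : 'M[R[i]]_(m, d)) : 'M[R[i]]_m :=
  (proj_ortho Y^T)^T.

End ComplexMatrices.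

Inductive sjlt_construction := Graph | Block.

Section SJLT.
Context {R : realType}.

Definition row_support n d (S : 'M[R]_(n, d)) (i : 'I_n) : {set 'I_d} :=
  [set j | S i j != 0]%SET.

Definition chunk d alpha (k : 'I_alpha) : {set 'I_d} :=
  [set j : 'I_d | (j %/ (d %/ alpha))%N == k]%SET.

(* Probability that the set of nonzero positions of one row equals B. *)
Definition row_support_prob (c : sjlt_construction) (d alpha : nat)
    (B : {set 'I_d}) : R :=
  match c with
  | Graph => if #|B| == alpha then ('C(d, alpha)%:R)^-1 else 0
  | Block => \prod_(k < alpha)
      (if #|B :&: chunk d k|%SET == 1%N then ((d %/ alpha)%N%:R)^-1 else 0)
  end.

Definition random_matrix disp (T : measurableType disp) (P : probability T R)
    n d (S : 'I_n -> 'I_d -> {RV P >-> R}) (w : T) : 'M[R]_(n, d) :=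
  \matrix_(i, j) S i j w.

(* In sjlt_signs, s i j selects the sign of the entry (i, j): conditionally on
   the supports of the rows, the n * alpha nonzero entries are independent
   and uniform on {1 / sqrt alpha, - 1 / sqrt alpha}. *)
Record is_SJLT disp (T : measurableType disp) (P : probability T R)
    (c : sjlt_construction) (n d alpha : nat)
    (S : 'I_n -> 'I_d -> {RV P >-> R}) : Prop := {
  sjlt_alpha_gt0 : (0 < alpha)%N ;
  sjlt_alpha_le : (alpha <= d)%N ;
  sjlt_chunks : c = Block -> (alpha %| d)%N ;
  sjlt_row_card : forall w i, #|row_support (random_matrix S w) i| = alpha ;
  sjlt_values : forall w i j, S i j w != 0 ->
    S i j w = (Num.sqrt alpha%:R)^-1 \/ S i j w = - (Num.sqrt alpha%:R)^-1 ;
  sjlt_positions : forall B : 'I_n -> {set 'I_d},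
    P [set w | forall i, row_support (random_matrix S w) i = B i]
      = (\prod_i row_support_prob c alpha (B i))%:E ;
  sjlt_signs : forall (B : 'I_n -> {set 'I_d}) (s : 'I_n -> 'I_d -> bool),
    P [set w | (forall i, row_support (random_matrix S w) i = B i) /\
               (forall i j, j \in B i ->
                  S i j w = (-1) ^+ s i j * (Num.sqrt alpha%:R)^-1)]
      = (P [set w | forall i, row_support (random_matrix S w) i = B i]
         * (\prod_i \prod_(j in B i) 2^-1)%:E)%E
}.

End SJLT.

(* Main.v *)
(* Let V hold the top r right singular vectors of A (rows v_i) and let S be the
   sketch.  Correcting a unit vector by an element of the range of S that matches
   its V-component shows that the error is at most
   sigma_(r+1) sqrt(1 + |S|^2 / lambda_min(V^* S S^* V)).  Since every row of S has
   alpha entries of size alpha^(-1/2), |S|^2 is at most the largest number of nonzeros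
   in a column, which is controlled by a Chernoff bound.

   For the lower bound on V^* S S^* V, condition on the positions of the nonzeros
   and reveal the signs row by row.  Then V^* S S^* V - 1 is a matrix martingale
   with increments s K / alpha, where K = v u^* + u v^* is predictable, and
   tr exp(sum (s K - 2 K^2)) is a supermartingale.  This follows from Klein's
   inequality and a mean value inequality for the trace, without Lieb's theorem.
   The quadratic variation sum K^2 splits into a part with weights |u|^2, handled by
   a scalar exponential moment, and a part sum |v|^2 u u^*, which is a deterministic
   matrix plus a martingale with the same increments reweighted; hence it is bounded
   in terms of itself.  All the randomness of the positions is summarised by the
   moment sum_j |v_j|^2 exp(sum_(i <> j) |v_i|^2 |N_i cap N_j|), whose mean is O(r).

   If delta is so close to 1 that log(r/delta) is tiny, then r = 1 and it is enough
   that the Rademacher chaos V^* S S^* V - 1 is nonnegative with probability bounded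
   below, which follows from Bonami's fourth-moment inequality. *)

Require Import Defs.
From mathcomp Require Import ring lra.

Set Implicit Arguments.
Unset Strict Implicit.
Unset Printing Implicit Defensive.

Import Order.TTheory GRing.Theory Num.Theory.
Import numFieldNormedType.Exports.

Local Open Scope classical_set_scope.
Local Open Scope ring_scope.
Local Open Scope sesquilinear_scope.

(** * Hermitian forms and trace exponentials *)

Section HermitianForms.
Context {R : realType}.
Local Notation C := R[i].
Local Notation conjC := (@Num.conj C).

Definition sqn (z : C) : R := complex.Re z ^+ 2 + complex.Im z ^+ 2.
Definition ip n (x y : 'rV[C]_n) : C := (x *m y ^t*) 0 0.
Definition nsq n (x : 'rV[C]_n) : R := complex.Re (ip x x).
Definition qf n (A : 'M[C]_n) (x : 'rV[C]_n) : R := complex.Re (ip (x *m A) x).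
Definition herm n (A : 'M[C]_n) := A ^t* = A.

Lemma ReD (x y : C) : complex.Re (x + y) = complex.Re x + complex.Re y.
Proof. by case: x y => [a b] [c e]. Qed.
Lemma ReN (x : C) : complex.Re (- x) = - complex.Re x.
Proof. by case: x. Qed.
Lemma ReZ (a : R) (x : C) : complex.Re (a%:C%C * x) = a * complex.Re x.
Proof. by case: x => c e; rewrite /= mul0r subr0. Qed.
Lemma Re_sum (I : Type) (s : seq I) (P : pred I) (F : I -> C) :
  complex.Re (\sum_(i <- s | P i) F i) = \sum_(i <- s | P i) complex.Re (F i).
Proof.
elim: s => [|a s IH]; first by rewrite !big_nil.
by rewrite !big_cons; case: (P a) => //; rewrite ReD IH.
Qed.
Lemma Re_conjC (z : C) : @complex.Re R (conjC z) = complex.Re z.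
Proof. by case: z. Qed.

Lemma sqn_ge0 z : 0 <= sqn z.
Proof. by rewrite addr_ge0 ?sqr_ge0. Qed.
Lemma sqnM x y : sqn (x * y) = sqn x * sqn y.
Proof. by case: x y => [a b] [c e]; rewrite /sqn /=; ring. Qed.
Lemma sqn_real (a : R) : sqn a%:C%C = a ^+ 2.
Proof. by rewrite /sqn /= expr0n addr0. Qed.
Lemma sqn_conj z : sqn (conjC z) = sqn z.
Proof. by case: z => a b; rewrite /sqn /= sqrrN. Qed.
Lemma sqnE z : sqn z = @complex.Re R (z * conjC z).
Proof. by case: z => a b; rewrite /sqn /=; ring. Qed.

Lemma ipDl n (x y z : 'rV[C]_n) : ip (x + y) z = ip x z + ip y z.
Proof. by rewrite /ip mulmxDl mxE. Qed.
Lemma ipNl n (x z : 'rV[C]_n) : ip (- x) z = - ip x z.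
Proof. by rewrite /ip mulNmx mxE. Qed.
Lemma ipZl n a (x z : 'rV[C]_n) : ip (a *: x) z = a * ip x z.
Proof. by rewrite /ip -scalemxAl mxE. Qed.
Lemma ipE n (x y : 'rV[C]_n) : ip x y = \sum_i x 0 i * conjC (y 0 i).
Proof. by rewrite /ip mxE; apply: eq_bigr => i _; rewrite !mxE. Qed.
Lemma ip_conj n (x y : 'rV[C]_n) : conjC (ip x y) = ip y x.
Proof.
rewrite !ipE rmorph_sum; apply: eq_bigr => i _.
by rewrite rmorphM /= conjCK mulrC.
Qed.
Lemma sqn_ipC n (x y : 'rV[C]_n) : sqn (ip x y) = sqn (ip y x).
Proof. by rewrite -ip_conj sqn_conj. Qed.
Lemma ip_herm n (A : 'M[C]_n) (x y : 'rV[C]_n) :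
  herm A -> ip (x *m A) y = ip x (y *m A).
Proof. by move=> hA; rewrite /ip trmx_mul map_mxM hA mulmxA. Qed.

Lemma nsqE n (x : 'rV[C]_n) : nsq x = \sum_i sqn (x 0 i).
Proof. by rewrite /nsq ipE Re_sum; apply: eq_bigr => i _; rewrite sqnE. Qed.
Lemma nsq_ge0 n (x : 'rV[C]_n) : 0 <= nsq x.
Proof. by rewrite nsqE sumr_ge0 // => i _; apply: sqn_ge0. Qed.

Lemma qfD n (A B : 'M[C]_n) x : qf (A + B) x = qf A x + qf B x.
Proof. by rewrite /qf mulmxDr ipDl ReD. Qed.
Lemma qfN n (A : 'M[C]_n) x : qf (- A) x = - qf A x.
Proof. by rewrite /qf mulmxN ipNl ReN. Qed.
Lemma qfZ n (a : R) (A : 'M[C]_n) x : qf (a%:C%C *: A) x = a * qf A x.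
Proof. by rewrite /qf -scalemxAr ipZl ReZ. Qed.
Lemma qf0 n (x : 'rV[C]_n) : qf 0 x = 0.
Proof. by rewrite /qf mulmx0 /ip mul0mx mxE. Qed.
Lemma qf_sum n (I : Type) (s : seq I) (P : pred I) (F : I -> 'M[C]_n) x :
  qf (\sum_(i <- s | P i) F i) x = \sum_(i <- s | P i) qf (F i) x.
Proof.
elim: s => [|a s IH]; first by rewrite !big_nil qf0.
by rewrite !big_cons; case: (P a) => //; rewrite qfD IH.
Qed.
Lemma qf_sqr n (D : 'M[C]_n) x : herm D -> qf (D *m D) x = nsq (x *m D).
Proof. by move=> hD; rewrite /qf /nsq mulmxA ip_herm. Qed.

Lemma hermD n (A B : 'M[C]_n) : herm A -> herm B -> herm (A + B).
Proof. by move=> hA hB; rewrite /herm linearD map_mxD /= hA hB. Qed.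
Lemma hermN n (A : 'M[C]_n) : herm A -> herm (- A).
Proof. by move=> hA; rewrite /herm linearN map_mxN /= hA. Qed.
Lemma hermZ n (a : R) (A : 'M[C]_n) : herm A -> herm (a%:C%C *: A).
Proof.
move=> hA; rewrite /herm linearZ map_mxZ /= hA; congr (_ *: _).
by congr Complex; rewrite oppr0.
Qed.
Lemma herm_sqr n (A : 'M[C]_n) : herm A -> herm (A *m A).
Proof. by move=> hA; rewrite /herm trmx_mul map_mxM hA. Qed.
Lemma herm0 n : herm (0 : 'M[C]_n).
Proof. by rewrite /herm trmx0 map_mx0. Qed.
Lemma herm_sum n (I : Type) (s : seq I) (F : I -> 'M[C]_n) :
  (forall i, herm (F i)) -> herm (\sum_(i <- s) F i).
Proof.
move=> hF; elim: s => [|a s IH]; first by rewrite big_nil; apply: herm0.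
by rewrite big_cons; apply: hermD.
Qed.

(** Eigenvalues of a Hermitian matrix are real, so the real part loses nothing and exponentials stay
    in [R]. Rows of [spectralmx] are eigenvectors for the action on row vectors. *)
Definition ev n (A : 'M[C]_n) i : R := complex.Re (spectral_diag A 0 i).
Definition evec n (A : 'M[C]_n) i : 'rV[C]_n := row i (spectralmx A).

Lemma spectral_diagE n (A : 'M[C]_n) i :
  herm A -> spectral_diag A 0 i = (ev A i)%:C%C.
Proof.
move=> hA; have /mxOverP/(_ 0 i) : spectral_diag A \is a realmx.
  apply: hermitian_spectral_diag_real; apply/is_hermitianmxP.
  by rewrite expr0 scale1r hA.
by move/complex_realP => [k hk]; rewrite /ev hk.
Qed.

Lemma spectralE n (A : 'M[C]_n) : herm A ->
  spectralmx A *m A = diag_mx (spectral_diag A) *m spectralmx A.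
Proof.
move=> hA; have /orthomx_spectralP eqA : A \is normalmx.
  by apply/normalmxP; rewrite hA.
by move/(congr1 (mulmx (spectralmx A))): eqA; rewrite !mulmxA mulmxV ?spectral_unit// mul1mx.
Qed.

Lemma evec_mul n (A : 'M[C]_n) i :
  herm A -> evec A i *m A = (ev A i)%:C%C *: evec A i.
Proof.
move=> hA; rewrite /evec -row_mul spectralE // -spectral_diagE //.
by rewrite mul_diag_mx; apply/rowP => j; rewrite !mxE.
Qed.

Lemma ip_evec n (A : 'M[C]_n) i j : ip (evec A i) (evec A j) = (i == j)%:R.
Proof.
have /unitarymxP/matrixP/(_ i j) := spectral_unitarymx A; rewrite !mxE => <-.
by rewrite ipE; apply: eq_bigr => k _; rewrite !mxE.
Qed.

Lemma parseval n (A : 'M[C]_n) x y :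
  ip x y = \sum_i ip x (evec A i) * ip (evec A i) y.
Proof.
have U : (spectralmx A)^t* *m spectralmx A = 1%:M.
  have := spectral_unitarymx A.
  by rewrite -trmxC_unitary => /unitarymxP; rewrite trmxCK.
transitivity (((x *m (spectralmx A)^t*) *m (spectralmx A *m y^t*)) 0 0).
  by rewrite mulmxA -(mulmxA x) U mulmx1.
rewrite mxE; apply: eq_bigr => i _; congr (_ * _).
  by rewrite ipE mxE; apply: eq_bigr => k _; rewrite !mxE.
by rewrite ipE mxE; apply: eq_bigr => k _; rewrite !mxE.
Qed.

Lemma nsq_parseval n (A : 'M[C]_n) x : nsq x = \sum_i sqn (ip x (evec A i)).
Proof.
rewrite /nsq (parseval A) Re_sum; apply: eq_bigr => i _.
by rewrite sqnE ip_conj.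
Qed.

Lemma nsq_evec n (A : 'M[C]_n) i : nsq (evec A i) = 1.
Proof. by rewrite /nsq ip_evec eqxx. Qed.

Lemma ip_mul_evec n (A : 'M[C]_n) x j :
  herm A -> ip (x *m A) (evec A j) = (ev A j)%:C%C * ip x (evec A j).
Proof.
move=> hA; rewrite ip_herm // evec_mul // -ip_conj ipZl rmorphM /= ip_conj.
by congr (_ * _); congr Complex; rewrite oppr0.
Qed.

Lemma qf_spectral n (A : 'M[C]_n) x :
  herm A -> qf A x = \sum_i ev A i * sqn (ip x (evec A i)).
Proof.
move=> hA; rewrite /qf (parseval A) Re_sum; apply: eq_bigr => i _.
by rewrite ip_mul_evec // -mulrA ReZ sqnE ip_conj.
Qed.

Lemma qf_evec n (A : 'M[C]_n) i : herm A -> qf A (evec A i) = ev A i.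
Proof. by move=> hA; rewrite /qf evec_mul // ipZl ReZ ip_evec eqxx mulr1. Qed.

Lemma nsq_evec_sub n (A B : 'M[C]_n) i : herm A -> herm B ->
  nsq (evec A i *m (A - B)) =
  \sum_j (ev A i - ev B j) ^+ 2 * sqn (ip (evec A i) (evec B j)).
Proof.
move=> hA hB; rewrite (nsq_parseval B); apply: eq_bigr => j _.
rewrite mulmxBr ipDl ipNl ip_mul_evec // evec_mul // ipZl -mulrBl sqnM.
by rewrite -rmorphB sqn_real.
Qed.

Definition trexp n (A : 'M[C]_n) : R := \sum_i expR (ev A i).
(* [tre M A] is tr (M exp A). *)
Definition tre n (M A : 'M[C]_n) : R := \sum_i expR (ev A i) * qf M (evec A i).

Lemma treD n (M N A : 'M[C]_n) : tre (M + N) A = tre M A + tre N A.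
Proof.
by rewrite /tre -big_split; apply: eq_bigr => i _; rewrite qfD mulrDr.
Qed.
Lemma treZ n a (M A : 'M[C]_n) : tre (a%:C%C *: M) A = a * tre M A.
Proof.
by rewrite /tre mulr_sumr; apply: eq_bigr => i _; rewrite qfZ mulrCA.
Qed.
Lemma treN n (M A : 'M[C]_n) : tre (- M) A = - tre M A.
Proof.
by rewrite /tre -sumrN; apply: eq_bigr => i _; rewrite qfN mulrN.
Qed.

Lemma expR_klein (a b : R) : expR a + (b - a) * expR a <= expR b.
Proof.
have -> : expR b = expR (b - a) * expR a by rewrite -expRD subrK.
by rewrite -[X in X + _]mul1r -mulrDl ler_wpM2r ?expR_ge0 // expR_ge1Dx.
Qed.

(** The mean value theorem for exp, with the slope bounded by the sum of the endpoint slopes; the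
    tangent line at the larger endpoint suffices. *)
Lemma expR_mean_value (a b : R) :
  (expR a - expR b) * (a - b) <= (expR a + expR b) * (a - b) ^+ 2.
Proof.
have := expR_klein a b; have := expR_klein b a.
have := expR_ge0 a; have := expR_ge0 b; move: (expR a) (expR b) => p q.
move=> q0 p0 k2 k1; rewrite expr2 mulrA.
have [le_ab|/ltW le_ba] := leP a b.
  apply: ler_wnM2r; first by rewrite subr_le0.
  have : 0 <= p * (b - a) by rewrite mulr_ge0 ?subr_ge0.
  lra.
apply: ler_wpM2r; first by rewrite subr_ge0.
have : 0 <= q * (a - b) by rewrite mulr_ge0 ?subr_ge0.
lra.
Qed.

(** * Comparison of two Hermitian matrices through their eigenbases *)

Section TwoBases.
Context n (A B : 'M[C]_n) (hA : herm A) (hB : herm B).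
(** The squared overlaps of the two eigenbases form a doubly stochastic matrix. Traces thus become
    averages over pairs of eigenvalues, and scalar inequalities lift termwise. *)
Let w i j := sqn (ip (evec A i) (evec B j)).

Let sum_w_r i : \sum_j w i j = 1.
Proof. by rewrite -nsq_parseval nsq_evec. Qed.
Let sum_w_l j : \sum_i w i j = 1.
Proof.
rewrite -(nsq_evec B j) (nsq_parseval A).
by apply: eq_bigr => i _; rewrite /w sqn_ipC.
Qed.
Let w_ge0 i j : 0 <= w i j. Proof. exact: sqn_ge0. Qed.

Let split_l (f : 'I_n -> R) : \sum_i f i = \sum_i \sum_j f i * w i j.
Proof. by apply: eq_bigr => i _; rewrite -mulr_sumr sum_w_r mulr1. Qed.
Let split_r (f : 'I_n -> R) : \sum_j f j = \sum_i \sum_j f j * w i j.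
Proof.
rewrite exchange_big; apply: eq_bigr => j _.
by rewrite -mulr_sumr sum_w_l mulr1.
Qed.

Let qf_sub i : qf (B - A) (evec A i) = \sum_j (ev B j - ev A i) * w i j.
Proof.
rewrite qfD qfN qf_evec // qf_spectral //.
rewrite -[X in _ - X]mulr1 -(sum_w_r i) mulr_sumr -sumrB.
by apply: eq_bigr => j _; rewrite mulrBl.
Qed.

Let qf_sub2 j : qf (B - A) (evec B j) = \sum_i (ev B j - ev A i) * w i j.
Proof.
rewrite qfD qfN qf_evec // qf_spectral //.
rewrite -[X in X - _]mulr1 -(sum_w_l j) mulr_sumr -sumrB.
by apply: eq_bigr => i _; rewrite mulrBl /w sqn_ipC.
Qed.

Lemma trexp_klein : trexp A + tre (B - A) A <= trexp B.
Proof.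
rewrite /trexp /tre split_l split_r -big_split /= ler_sum // => i _.
rewrite qf_sub mulr_sumr -big_split /= ler_sum // => j _.
by rewrite mulrA -mulrDl ler_wpM2r // [expR _ * _]mulrC expR_klein.
Qed.

Lemma tre_mean_value :
  tre (A - B) A - tre (A - B) B <=
  tre ((A - B) *m (A - B)) A + tre ((A - B) *m (A - B)) B.
Proof.
have hD : herm (A - B) by apply: hermD => //; apply: hermN.
have e1 : tre (A - B) A =
    \sum_i \sum_j expR (ev A i) * (ev A i - ev B j) * w i j.
  apply: eq_bigr => i _; rewrite -[A - B]opprB qfN qf_sub -sumrN mulr_sumr.
  by apply: eq_bigr => j _; rewrite -mulNr opprB mulrA.
have e2 : tre (A - B) B =
    \sum_i \sum_j expR (ev B j) * (ev A i - ev B j) * w i j.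
  rewrite exchange_big; apply: eq_bigr => j _.
  rewrite -[A - B]opprB qfN qf_sub2 -sumrN mulr_sumr.
  by apply: eq_bigr => i _; rewrite -mulNr opprB mulrA.
have e3 : tre ((A - B) *m (A - B)) A =
    \sum_i \sum_j expR (ev A i) * (ev A i - ev B j) ^+ 2 * w i j.
  apply: eq_bigr => i _; rewrite qf_sqr // nsq_evec_sub // mulr_sumr.
  by apply: eq_bigr => j _; rewrite mulrA.
have e4 : tre ((A - B) *m (A - B)) B =
    \sum_i \sum_j expR (ev B j) * (ev A i - ev B j) ^+ 2 * w i j.
  rewrite exchange_big; apply: eq_bigr => j _.
  rewrite qf_sqr // -[A - B]opprB mulmxN.
  have -> (z : 'rV[C]_n) : nsq (- z) = nsq z.
    by rewrite !nsqE; apply: eq_bigr => k _; rewrite mxE /sqn !raddfN /= !sqrrN.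
  rewrite nsq_evec_sub // mulr_sumr.
  by apply: eq_bigr => i _; rewrite mulrA -sqrrN opprB /w sqn_ipC.
rewrite e1 e2 e3 e4 -sumrB -big_split ler_sum // => i _.
rewrite -sumrB -big_split ler_sum // => j _ /=.
by rewrite -mulrBl -mulrDl ler_wpM2r // -mulrBl -mulrDl expR_mean_value.
Qed.

End TwoBases.

(* Klein's inequality from [H +- K - 2 K^2] to [H] leaves the first-order term
   tr (K (exp A - exp B)), which [tre_mean_value] bounds by the second-order one. *)
Lemma trexp_rademacher n (H K : 'M[C]_n) : herm H -> herm K ->
  trexp (H + K - 2%:C%C *: (K *m K)) + trexp (H - K - 2%:C%C *: (K *m K))
  <= 2 * trexp H.
Proof.
move=> hH hK; set W := 2%:C%C *: (K *m K).
have hW : herm W by apply/hermZ/herm_sqr.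
set A := H + K - W; set B := H - K - W.
have hA : herm A by apply: hermD; [apply: hermD|apply: hermN].
have hB : herm B by apply: hermD; [apply: hermD => //|]; apply: hermN.
have := trexp_klein hA hH; have := trexp_klein hB hH.
have -> : H - A = W - K.
  by rewrite /A; apply/matrixP => i j; rewrite !mxE; ring.
have -> : H - B = W + K.
  by rewrite /B; apply/matrixP => i j; rewrite !mxE; ring.
have := tre_mean_value hA hB.
(* With [A - B = 2 K], [tre_mean_value] bounds tr K (exp A - exp B) by 2 tr K^2 (exp A + exp B). The
   two Klein bounds supply exactly this amount through [W], which fixes the constant 2. *)
have -> : A - B = 2%:C%C *: K.
  rewrite /A /B; apply/matrixP => i j; rewrite !mxE.
  have -> : (2 : R)%:C%C = 2 :> C by rewrite rmorph_nat.
  by ring.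
rewrite -scalemxAl -scalemxAr !treD !treN !treZ.
move: (trexp A) (trexp B) (trexp H) (tre K A) (tre K B).
by move: (tre (K *m K) A) (tre (K *m K) B) => *; lra.
Qed.

(** The exponential of the largest eigenvalue is one term of the trace. The right side does not
    involve [x], so one bound covers all unit vectors at once. *)
Lemma expR_qf_le_trexp n (A : 'M[C]_n) x :
  herm A -> nsq x = 1 -> qf A x <= ln (trexp A).
Proof.
move=> hA nx; have ev_le i : ev A i <= ln (trexp A).
  rewrite -ler_expR lnK; last first.
    rewrite posrE /trexp (bigD1 i) //= ltr_pwDl ?expR_gt0 //.
    by apply: sumr_ge0 => j _; apply: expR_ge0.
  rewrite /trexp (bigD1 i) //= lerDl.
  by apply: sumr_ge0 => j _; apply: expR_ge0.
rewrite qf_spectral // -[leRHS]mulr1 -nx (nsq_parseval A) mulr_sumr ler_sum //.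
by move=> i _; rewrite ler_wpM2r ?sqn_ge0.
Qed.

Lemma trexp0 n : trexp (0 : 'M[C]_n) = n%:R.
Proof.
rewrite /trexp (eq_bigr (fun=> 1)); last first.
  by move=> i _; rewrite -qf_evec ?qf0 ?expR0 //; apply: herm0.
by rewrite sumr_const card_ord.
Qed.

Lemma trexp_gt0 n (A : 'M[C]_n) : (0 < n)%N -> 0 < trexp A.
Proof.
move=> n0; rewrite /trexp (bigD1 (Ordinal n0)) //= ltr_pwDl ?expR_gt0 //.
by apply: sumr_ge0 => j _; apply: expR_ge0.
Qed.

End HermitianForms.

(** * Averages over signs *)

Section SignAverages.
Context {R : realType} (I : finType).
Local Notation S := {ffun I -> bool}.

Definition sg (b : bool) : R := (-1) ^+ b.
Definition Esg (f : S -> R) : R := #|{: S}|%:R^-1 * \sum_s f s.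
Definition flip (p : I) (s : S) : S :=
  [ffun q => if q == p then ~~ s q else s q].

Lemma sgN b : sg (~~ b) = - sg b.
Proof. by case: b; rewrite /sg /= ?expr0 ?expr1 ?opprK. Qed.
Lemma sg_sqr b : sg b ^+ 2 = 1.
Proof. by rewrite /sg sqrr_sign. Qed.
Lemma flip_at p s : flip p s p = ~~ s p.
Proof. by rewrite ffunE eqxx. Qed.
Lemma flip_other p q s : q != p -> flip p s q = s q.
Proof. by move=> h; rewrite ffunE (negPf h). Qed.
Lemma flipK p : involutive (flip p).
Proof.
move=> s; apply/ffunP => q; rewrite !ffunE; case: (q == p) => //.
exact: negbK.
Qed.

Let card_gt0 : 0 < #|{: S}|%:R :> R.
Proof. by rewrite ltr0n; apply/card_gt0P; exists [ffun=> true]. Qed.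

Lemma Esg_le f g : (forall s, f s <= g s) -> Esg f <= Esg g.
Proof.
by move=> h; rewrite ler_pM2l ?invr_gt0 // ler_sum // => s _.
Qed.
Lemma eq_Esg f g : (forall s, f s = g s) -> Esg f = Esg g.
Proof. by move=> h; congr (_ * _); apply: eq_bigr => s _. Qed.
Lemma EsgD f g : Esg (fun s => f s + g s) = Esg f + Esg g.
Proof. by rewrite /Esg big_split mulrDr. Qed.
Lemma EsgZ a f : Esg (fun s => a * f s) = a * Esg f.
Proof. by rewrite /Esg -mulr_sumr mulrCA. Qed.
Lemma Esg_cst a : Esg (fun=> a) = a.
Proof. by rewrite /Esg sumr_const -[a *+ _]mulr_natl mulKf // gt_eqF. Qed.
Lemma EsgN f : Esg (fun s => - f s) = - Esg f.
Proof. by rewrite /Esg sumrN mulrN. Qed.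
Lemma Esg_sum (J : Type) (r : seq J) (F : J -> S -> R) :
  Esg (fun s => \sum_(j <- r) F j s) = \sum_(j <- r) Esg (F j).
Proof. by rewrite /Esg exchange_big mulr_sumr. Qed.
Lemma Esg_ge0 f : (forall s, 0 <= f s) -> 0 <= Esg f.
Proof. by move=> h; rewrite -(Esg_cst 0); apply: Esg_le. Qed.
Lemma Esg_flip p f : Esg (fun s => f (flip p s)) = Esg f.
Proof.
congr (_ * _); rewrite [RHS](reindex_inj (h := flip p)) //.
exact: inv_inj (flipK p).
Qed.
(** Averaging out one sign: [s] is paired with its flip, in place of a conditional expectation. *)
Lemma Esg_flip_le p f g :
  (forall s, f s + f (flip p s) <= 2 * g s) -> Esg f <= Esg g.
Proof.
move=> h; have : Esg f + Esg (fun s => f (flip p s)) <= 2 * Esg g.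
  by rewrite -EsgD -EsgZ; apply: Esg_le.
by rewrite Esg_flip => ?; lra.
Qed.
Lemma Esg_eq0 f : (forall s, 0 <= f s) -> Esg f = 0 -> forall s, f s = 0.
Proof.
move=> h /eqP; rewrite mulf_eq0 invr_eq0 gt_eqF //= => /eqP e s.
by apply: (psumr_eq0P _ e).
Qed.

(** * Martingales in signs revealed in a fixed order *)

Section Ordered.
Context (rho : I -> nat) (rho_inj : injective rho).

(* [rho] is the order in which the signs are revealed: [a q] may only depend on
   signs of rank smaller than that of [q]. *)
Definition predictable (X : Type) (a : I -> S -> X) :=
  forall p q s, (rho q <= rho p)%N -> a q (flip p s) = a q s.

(** Ranks may have gaps, so passing from [t] to [t.+1] adds either the single index of rank [t] or
    nothing. *)
Let partial (M : nmodType) (a : I -> S -> M) t s :=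
  \sum_(p | (rho p < t)%N) a p s.

Let partialS (M : nmodType) (a : I -> S -> M) t s p : rho p = t ->
  partial a t.+1 s = partial a t s + a p s.
Proof.
move=> e; rewrite /partial (bigD1 p) /=; last by rewrite e.
rewrite addrC; congr (_ + _); apply: eq_bigl => q.
rewrite ltnS leq_eqVlt -e; have [-> | ne] := eqVneq q p.
  by rewrite ltnn eqxx andbF.
by rewrite andbT (inj_eq rho_inj) (negPf ne).
Qed.

Let partialN (M : nmodType) (a : I -> S -> M) t s : (forall p, rho p != t) ->
  partial a t.+1 s = partial a t s.
Proof.
by move=> e; apply: eq_bigl => q; rewrite ltnS leq_eqVlt (negPf (e q)).
Qed.

Let partial_all (M : nmodType) (a : I -> S -> M) s :
  partial a (\max_p rho p).+1 s = \sum_p a p s.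
Proof. by apply: eq_bigl => q; rewrite ltnS (leq_bigmax q). Qed.

Let partial0 (M : nmodType) (a : I -> S -> M) s : partial a 0 s = 0.
Proof. by rewrite /partial big_pred0. Qed.

Let partial_flip (M : nmodType) (a : I -> S -> M) t p s : rho p = t ->
  (forall q, (rho q < t)%N -> a q (flip p s) = a q s) ->
  partial a t (flip p s) = partial a t s.
Proof. by move=> e h; apply: eq_bigr => q /h. Qed.

(** Induction on the rank: flipping the sign of rank [t] changes neither the earlier partial sum nor
    the matrix [K p], so [trexp_rademacher] applies to the pair. *)
Lemma trexp_supermartingale n (K : I -> S -> 'M[R[i]]_n) :
  predictable K -> (forall p s, herm (K p s)) ->
  Esg (fun s => trexp (\sum_p ((sg (s p))%:C%C *: K p s -
                               2%:C%C *: (K p s *m K p s)))) <= n%:R.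
Proof.
move=> pK hK; pose a p (s : S) :=
  (sg (s p))%:C%C *: K p s - 2%:C%C *: (K p s *m K p s).
have ha p s : herm (a p s).
  by apply: hermD; [apply: hermZ|apply/hermN/hermZ/herm_sqr].
suff h t : Esg (fun s => trexp (partial a t s)) <= n%:R.
  rewrite (eq_Esg (g := fun s => trexp (partial a (\max_p rho p).+1 s))) //.
  by move=> s; rewrite partial_all.
elim: t => [|t IH].
  by rewrite (eq_Esg (g := fun=> n%:R)) ?Esg_cst // => s; rewrite partial0 trexp0.
have [/existsP[p /eqP e]|/existsPn h] := boolP [exists p, rho p == t]; last first.
  rewrite (eq_Esg (g := fun s => trexp (partial a t s))) // => s.
  by rewrite partialN.
apply: le_trans IH; apply: (Esg_flip_le (p := p)) => s.
rewrite (partialS a s e) (partialS a (flip p s) e).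
have -> : partial a t (flip p s) = partial a t s.
  apply: (partial_flip e) => q lt_qt; rewrite /a pK; last by rewrite e ltnW.
  by rewrite flip_other //; apply: contraTneq lt_qt => ->; rewrite e ltnn.
rewrite {2 4}/a pK // flip_at sgN.
have hH : herm (partial a t s).
  by rewrite /partial -big_filter; apply: herm_sum.
have := @trexp_rademacher R n _ _ hH (hermZ (sg (s p)) (hK p s)).
have -> : (sg (s p))%:C%C *: K p s *m ((sg (s p))%:C%C *: K p s) =
          K p s *m K p s.
  rewrite -scalemxAl -scalemxAr scalerA -rmorphM -expr2 sg_sqr.
  by rewrite rmorph1 scale1r.
by rewrite rmorphN scaleNr !addrA.
Qed.

Lemma Esg_mul_sign (f : S -> R) p :
  (forall s, f (flip p s) = f s) -> Esg (fun s => sg (s p) * f s) = 0.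
Proof.
move=> h; have := Esg_flip p (fun s => sg (s p) * f s).
rewrite (eq_Esg (g := fun s => - (sg (s p) * f s))); last first.
  by move=> s; rewrite flip_at sgN h mulNr.
by rewrite EsgN => ?; lra.
Qed.

Lemma Esg_martingale0 (a : I -> S -> R) : predictable a ->
  Esg (fun s => \sum_p sg (s p) * a p s) = 0.
Proof.
move=> pa; rewrite Esg_sum big1 // => p _.
by apply: Esg_mul_sign => s; apply: pa.
Qed.

(** Cauchy-Schwarz for the mixed moment, through a weighted arithmetic-geometric mean so that no
    square roots of moments appear. *)
Lemma Esg_sqr_mul (f g : S -> R) (A B k : R) : 0 <= k ->
  Esg (fun s => f s ^+ 2) = A -> Esg (fun s => g s ^+ 2) = B ->
  Esg (fun s => f s ^+ 4) <= 9 * k * A ^+ 2 ->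
  Esg (fun s => g s ^+ 4) <= k * B ^+ 2 ->
  Esg (fun s => f s ^+ 2 * g s ^+ 2) <= 3 * k * A * B.
Proof.
move=> k0 eA eB hf hg.
have A0 : 0 <= A by rewrite -eA; apply: Esg_ge0 => s; apply: sqr_ge0.
have B0 : 0 <= B by rewrite -eB; apply: Esg_ge0 => s; apply: sqr_ge0.
have [A00|An0] := eqVneq A 0.
  rewrite (eq_Esg (g := fun=> 0)) ?Esg_cst ?A00 ?mulr0 ?mul0r // => s.
  rewrite A00 in eA; rewrite (Esg_eq0 _ eA) ?mul0r // => t; exact: sqr_ge0.
have [B00|Bn0] := eqVneq B 0.
  rewrite (eq_Esg (g := fun=> 0)) ?Esg_cst ?B00 ?mulr0 // => s.
  rewrite B00 in eB; rewrite (Esg_eq0 _ eB) ?mulr0 // => t; exact: sqr_ge0.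
have {An0}A1 : 0 < A by rewrite lt_def An0.
have {Bn0}B1 : 0 < B by rewrite lt_def Bn0.
(* This weight makes both halves equal to 3 k A B / 2. *)
pose t := B / (3 * A); have t0 : 0 < t by rewrite divr_gt0 // mulr_gt0.
have h : Esg (fun s => f s ^+ 2 * g s ^+ 2) <=
    Esg (fun s => t / 2 * f s ^+ 4 + (2 * t)^-1 * g s ^+ 4).
  apply: Esg_le => s.
  have -> : t / 2 * f s ^+ 4 + (2 * t)^-1 * g s ^+ 4 =
      f s ^+ 2 * g s ^+ 2 + (2 * t)^-1 * (t * f s ^+ 2 - g s ^+ 2) ^+ 2.
    by field; rewrite gt_eqF.
  by rewrite lerDl mulr_ge0 ?sqr_ge0 // invr_ge0 mulr_ge0 // ltW.
apply: le_trans h _; rewrite EsgD !EsgZ.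
apply: (@le_trans _ _ (t / 2 * (9 * k * A ^+ 2) + (2 * t)^-1 * (k * B ^+ 2))).
  apply: lerD; rewrite ler_wpM2l //; first by rewrite divr_ge0 // ltW.
  by rewrite invr_ge0 mulr_ge0 // ltW.
rewrite le_eqVlt; apply/orP; left; apply/eqP; rewrite /t; field.
by rewrite !gt_eqF.
Qed.

(* Bonami's inequality, one degree at a time: fourth-moment constants go from
   [k] to [9 k] when the degree grows by one. *)
Lemma Esg_bonami (a : I -> S -> R) (k : R) : 0 <= k -> predictable a ->
  (forall p, Esg (fun s => a p s ^+ 4) <= k * Esg (fun s => a p s ^+ 2) ^+ 2) ->
  Esg (fun s => (\sum_p sg (s p) * a p s) ^+ 4) <=
  9 * k * Esg (fun s => (\sum_p sg (s p) * a p s) ^+ 2) ^+ 2.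
Proof.
move=> k0 pa ha; pose b p (s : S) := sg (s p) * a p s.
suff h t : Esg (fun s => partial b t s ^+ 4) <=
    9 * k * Esg (fun s => partial b t s ^+ 2) ^+ 2.
  have e j : Esg (fun s => (\sum_p b p s) ^+ j) =
      Esg (fun s => partial b (\max_p rho p).+1 s ^+ j).
    by apply: eq_Esg => s; rewrite partial_all.
  by rewrite !e.
elim: t => [|t IH].
  rewrite (eq_Esg (g := fun=> 0)) ?Esg_cst; last first.
    by move=> s; rewrite partial0 expr0n.
  by rewrite mulr_ge0 ?sqr_ge0 // mulr_ge0.
have [/existsP[p /eqP e]|/existsPn h] := boolP [exists p, rho p == t]; last first.
  rewrite (eq_Esg (g := fun s => partial b t s ^+ 4)); last first.
    by move=> s; rewrite partialN.
  rewrite [X in _ <= 9 * k * X ^+ 2](eq_Esg (g := fun s => partial b t s ^+ 2)) //.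
  by move=> s; rewrite partialN.
set f := partial b t; set g := a p.
have ff s : f (flip p s) = f s.
  apply: partial_flip => // q lt_qt; rewrite /b pa; last by rewrite e ltnW.
  by rewrite flip_other //; apply: contraTneq lt_qt => ->; rewrite e ltnn.
have gf s : g (flip p s) = g s by apply: pa.
set A := Esg (fun s => f s ^+ 2); set B := Esg (fun s => g s ^+ 2).
have hm := @Esg_sqr_mul f g A B k k0 erefl erefl IH (ha p).
have A0 : 0 <= A by apply: Esg_ge0 => s; apply: sqr_ge0.
have B0 : 0 <= B by apply: Esg_ge0 => s; apply: sqr_ge0.
have -> : Esg (fun s => partial b t.+1 s ^+ 2) = A + B.
  rewrite (eq_Esg (g := fun s => f s ^+ 2 + g s ^+ 2 +
                               2 * (sg (s p) * (f s * g s)))).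
    rewrite !EsgD EsgZ (@Esg_mul_sign (fun s => f s * g s)) ?mulr0 ?addr0 //.
    by move=> s; rewrite ff gf.
  move=> s; rewrite (partialS b s e) -/f /b -/(g s).
  by have := sg_sqr (s p); move: (sg _) => z hz; ring: hz.
(* Odd powers of the newest sign average to zero. The rest is at most k (9 A^2 + 18 A B + B^2) <= 9
   k (A + B)^2. *)
rewrite (eq_Esg (g := fun s => f s ^+ 4 + 6 * (f s ^+ 2 * g s ^+ 2) + g s ^+ 4 +
             4 * (sg (s p) * (f s ^+ 3 * g s + f s * g s ^+ 3)))); last first.
  move=> s; rewrite (partialS b s e) -/f /b -/(g s).
  by have := sg_sqr (s p); move: (sg _) => z hz; ring: hz.
rewrite !EsgD !EsgZ (@Esg_mul_sign (fun s => f s ^+ 3 * g s + f s * g s ^+ 3));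
  last by move=> s; rewrite ff gf.
have hk : 0 <= k * B ^+ 2 by rewrite mulr_ge0 ?sqr_ge0.
have hgp := ha p; rewrite -/g -/B in hgp; rewrite -/A in IH.
by rewrite -/f in IH; lra.
Qed.

End Ordered.

(* On the line, [(5 x + x^2 - x^4 / 162) / 90 <= 1_(x >= 0)]. *)
Lemma Esg_anticoncentration (X : S -> R) : Esg X = 0 ->
  Esg (fun s => X s ^+ 4) <= 81 * Esg (fun s => X s ^+ 2) ^+ 2 ->
  180^-1 <= Esg (fun s => (0 <= X s)%R%:R).
Proof.
move=> X0 X4; set v := Esg (fun s => X s ^+ 2) in X4.
have v0 : 0 <= v by apply: Esg_ge0 => s; apply: sqr_ge0.
have [vz|vn0] := eqVneq v 0.
  rewrite (eq_Esg (g := fun=> 1)) ?Esg_cst ?invf_le1 //; first by lra.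
  move=> s; have := Esg_eq0 (fun s => sqr_ge0 _) vz s.
  by move/eqP; rewrite sqrf_eq0 => /eqP ->; rewrite lexx.
have {vn0}v1 : 0 < v by rewrite lt_def vn0.
pose w := (Num.sqrt v)^-1.
have w1 : 0 < w by rewrite invr_gt0 sqrtr_gt0.
have wv : w ^+ 2 * v = 1.
  by rewrite exprVn sqr_sqrtr // mulVf // gt_eqF.
have hp (x : R) : (5 * x + x ^+ 2 - x ^+ 4 / 162) / 90 <= (0 <= x)%R%:R.
  case: (lerP 0 x) => x0; rewrite /= ?mulr1n ?mulr0n.
    have : 0 <= (x ^+ 2 - 100) ^+ 2 by apply: sqr_ge0.
    have : 0 <= (x - 405 / 38) ^+ 2 by apply: sqr_ge0.
    have -> : (x ^+ 2 - 100) ^+ 2 = x ^+ 4 - 200 * x ^+ 2 + 10000 by ring.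
    lra.
  have h : x * (5 + x - x ^+ 3 / 162) <= 0.
    rewrite nmulr_rle0 //.
    have e : x ^+ 2 * x = x ^+ 3 by ring.
    have : 0 <= (- x) * (x + 10) ^+ 2 by rewrite mulr_ge0 ?sqr_ge0 // oppr_ge0 ltW.
    have : 0 <= (- x) * (x + 7) ^+ 2 by rewrite mulr_ge0 ?sqr_ge0 // oppr_ge0 ltW.
    nra.
  have e4 : x ^+ 4 = x * x ^+ 3 by ring.
  by rewrite e4; nra.
have := Esg_le (fun s => hp (w * X s)).
rewrite (eq_Esg (g := fun s => 90^-1 * (5 * w) * X s + 90^-1 * w ^+ 2 * X s ^+ 2 +
    - (90^-1 * w ^+ 4 / 162) * X s ^+ 4)); last by move=> s; field.
rewrite !EsgD !EsgZ X0 -/v mulr0 add0r.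
have -> : 90^-1 * w ^+ 2 * v = 90^-1 by rewrite -mulrA wv mulr1.
(* [w * X] has second moment 1 and fourth moment at most 81, so the polynomial averages to at least
   (1 - 81/162) / 90 = 1/180. *)
have : w ^+ 4 * Esg (fun s => X s ^+ 4) <= 81.
  apply: (@le_trans _ _ (w ^+ 4 * (81 * v ^+ 2))).
    by rewrite ler_wpM2l // exprn_ge0 // ltW.
  have -> : w ^+ 4 * (81 * v ^+ 2) = 81 * (w ^+ 2 * v) ^+ 2 by ring.
  by rewrite wv expr1n mulr1.
move=> h1; under [X in _ <= X]eq_Esg => s do rewrite pmulr_rge0 //.
by apply: le_trans; lra.
Qed.

(** The tangent bound 1 + t <= exp t gives exp x <= exp(x^2) / (1 + x^2 - x), and likewise for -x;
    the two reciprocals add up to at most 2. *)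
Lemma coshR_le (x : R) : expR x + expR (- x) <= 2 * expR (x ^+ 2).
Proof.
have h (y : R) : (1 + x ^+ 2 - y) * expR y <= expR (x ^+ 2).
  have -> : expR (x ^+ 2) = expR (x ^+ 2 - y) * expR y by rewrite -expRD subrK.
  by rewrite ler_wpM2r ?expR_ge0 // -addrA expR_ge1Dx.
have h1 := h x; have := h (- x); rewrite opprK => h2.
have p1 : 0 < 1 + x ^+ 2 - x by nra.
have p2 : 0 < 1 + x ^+ 2 + x by nra.
have e0 := expR_gt0 (x ^+ 2); set w := expR (x ^+ 2) in h1 h2 e0 *.
move: h1 h2; rewrite mulrC -ler_pdivlMr // [X in X <= w -> _]mulrC -ler_pdivlMr //.
move=> h1 h2; apply: le_trans (lerD h1 h2) _.
have -> : w / (1 + x ^+ 2 - x) + w / (1 + x ^+ 2 + x) =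
  w * ((2 + 2 * x ^+ 2) / (1 + x ^+ 2 + x ^+ 4)).
  have -> : 1 + x ^+ 2 + x ^+ 4 = (1 + x ^+ 2 - x) * (1 + x ^+ 2 + x) by ring.
  by field; rewrite !gt_eqF.
have x4 : 0 <= x ^+ 4 by rewrite (exprM x 2 2) sqr_ge0.
have x2 : 0 <= x ^+ 2 := sqr_ge0 x.
rewrite mulrC ler_wpM2r ?(ltW e0) //.
by rewrite ler_pdivrMr; lra.
Qed.

End SignAverages.

(** * Vectors and Rademacher sums *)

Section VectorFacts.
Context {R : realType}.
Local Notation C := R[i].


Lemma ipDr n (x y z : 'rV[C]_n) : ip z (x + y) = ip z x + ip z y.
Proof. by rewrite -ip_conj ipDl rmorphD /= !ip_conj. Qed.
Lemma ipZr n a (x z : 'rV[C]_n) : ip z (a *: x) = Num.conj a * ip z x.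
Proof. by rewrite -ip_conj ipZl rmorphM /= ip_conj. Qed.
Lemma conj_real (a : R) : Num.conj (a%:C%C : C) = a%:C%C.
Proof. by congr Complex; rewrite oppr0. Qed.
Lemma ip0r n (x : 'rV[C]_n) : ip x 0 = 0.
Proof. by rewrite -(scale0r 0) ipZr rmorph0 mul0r. Qed.
Lemma ip_sumr n (I : Type) (s : seq I) (P : pred I) (F : I -> 'rV[C]_n) x :
  ip x (\sum_(i <- s | P i) F i) = \sum_(i <- s | P i) ip x (F i).
Proof.
elim: s => [|a s IH]; first by rewrite !big_nil ip0r.
by rewrite !big_cons; case: (P a) => //; rewrite ipDr IH.
Qed.

Lemma Re_ipC n (x y : 'rV[C]_n) : complex.Re (ip y x) = complex.Re (ip x y).
Proof. by rewrite -ip_conj Re_conjC. Qed.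
Lemma nsqD n (x y : 'rV[C]_n) :
  nsq (x + y) = nsq x + nsq y + 2 * complex.Re (ip x y).
Proof.
by rewrite /nsq ipDl !ipDr !ReD (Re_ipC x y); ring.
Qed.
Lemma nsqZ n (a : C) (x : 'rV[C]_n) : nsq (a *: x) = sqn a * nsq x.
Proof. by rewrite !nsqE mulr_sumr; apply: eq_bigr => i _; rewrite mxE sqnM. Qed.
Lemma nsq0 n : nsq (0 : 'rV[C]_n) = 0.
Proof. by rewrite /nsq ip0r. Qed.
Lemma nsqD_le n (x y : 'rV[C]_n) : nsq (x + y) <= 2 * nsq x + 2 * nsq y.
Proof.
have := nsq_ge0 (x + -1 *: y); rewrite !nsqD nsqZ ipZr.
have -> : Num.conj (-1 : C) = (-1)%:C%C.
  by rewrite rmorphN1 [in RHS]rmorphN rmorph1.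
rewrite ReZ.
have -> : sqn (-1 : C) = 1 by rewrite /sqn /= oppr0 expr0n addr0 sqrrN expr1n.
by move=> ?; lra.
Qed.

Lemma sqn_eq0 (z : C) : sqn z = 0 -> z = 0.
Proof.
move/eqP; rewrite /sqn paddr_eq0 ?sqr_ge0 // !sqrf_eq0.
by case: z => a b /= /andP[/eqP -> /eqP ->].
Qed.
Lemma nsq_eq0 n (x : 'rV[C]_n) : nsq x = 0 -> x = 0.
Proof.
move=> e; apply/rowP => i; rewrite mxE; apply: sqn_eq0.
by apply: (psumr_eq0P _ (etrans (esym (nsqE x)) e)) => // k _; apply: sqn_ge0.
Qed.

Lemma cauchy_schwarz n (x y : 'rV[C]_n) : sqn (ip x y) <= nsq x * nsq y.
Proof.
have [y0|yn0] := eqVneq (nsq y) 0.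
  by rewrite (nsq_eq0 y0) ip0r nsq0 mulr0 /sqn /= expr0n addr0.
have {yn0}y1 : 0 < nsq y by rewrite lt_def yn0 nsq_ge0.
have := nsq_ge0 ((nsq y)%:C%C *: x + (- ip x y) *: y).
rewrite nsqD !nsqZ sqn_real ipZl ReZ ipZr rmorphN /= mulNr ReN mulrC.
rewrite [_ * ip x y]mulrC -sqnE.
have -> : sqn (- ip x y) = sqn (ip x y) by rewrite /sqn !raddfN /= !sqrrN.
by move=> h; rewrite -(ler_pM2l y1); nra.
Qed.

Lemma Re_sqr_le_sqn (z : C) : complex.Re z ^+ 2 <= sqn z.
Proof. by rewrite lerDl sqr_ge0. Qed.

(** Jensen's inequality with weights dominated by [a]. In the applications [w] depends on a unit
    vector and [a] does not, so the bound is uniform over the sphere. *)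
Lemma wsum_le_ln (I : finType) (w a t : I -> R) :
  (forall i, 0 <= w i) -> (forall i, w i <= a i) -> \sum_i w i = 1 ->
  \sum_i w i * t i <= ln (\sum_i a i * expR (t i)) + 1.
Proof.
move=> w0 wa w1; set P := \sum_i _ * expR _.
have P0 : 0 < P.
  apply: (@lt_le_trans _ _ (\sum_i w i * expR (t i))); last first.
    by apply: ler_sum => i _; rewrite ler_wpM2r ?expR_ge0.
  rewrite lt_def sumr_ge0 ?andbT; last by move=> i _; rewrite mulr_ge0 ?expR_ge0.
  apply/eqP => e; have : \sum_i w i = 0.
    rewrite big1 // => i _.
    have /eqP : w i * expR (t i) = 0.
      by apply: (psumr_eq0P _ e) => // j _; rewrite mulr_ge0 ?expR_ge0.
    by rewrite mulf_eq0 [expR _ == _]gt_eqF ?expR_gt0 // orbF => /eqP.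
  by rewrite w1 => /eqP; rewrite oner_eq0.
have h i : w i * t i <= w i * ln P + P^-1 * (a i * expR (t i)).
  have e : expR (t i - ln P) = P^-1 * expR (t i).
    by rewrite expRD expRN lnK ?posrE // mulrC.
  have := expR_ge1Dx (t i - ln P); rewrite e => h.
  apply: (@le_trans _ _ (w i * ln P + P^-1 * (w i * expR (t i)))).
    by rewrite [P^-1 * _]mulrCA -mulrDr ler_wpM2l //; lra.
  by rewrite lerD2l ler_wpM2l ?invr_ge0 ?(ltW P0) // ler_wpM2r ?expR_ge0.
apply: le_trans (ler_sum _ (fun i _ => h i)) _.
rewrite big_split -mulr_suml w1 mul1r -mulr_sumr -/P mulVf ?lerD2l //.
by rewrite gt_eqF.
Qed.

End VectorFacts.

(** * Exponential moments of signed vector sums in the columns *)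

Section RademacherVectors.
Context {R : realType} (n d r : nat).
Local Notation C := R[i].
Local Notation I := ('I_n * 'I_d)%type.
Local Notation S := {ffun I -> bool}.

Definition rvec (z : I -> 'rV[C]_r) (l : seq I) (k : 'I_d) (s : S) : 'rV[C]_r :=
  \sum_(p <- l | p.2 == k) (sg (s p) : R)%:C%C *: z p.
Definition mass (z : I -> 'rV[C]_r) (l : seq I) (k : 'I_d) : R :=
  \sum_(p <- l | p.2 == k) nsq (z p).

Lemma mass_ge0 z l k : 0 <= mass z l k.
Proof. by apply: sumr_ge0 => p _; apply: nsq_ge0. Qed.

(* Averaging one sign out of [|w + s z|^2] turns the coefficient [m] of
   [|w|^2] into [m (1 + 4 m |z|^2)], which preserves the condition
   [8 m * mass <= 1] because [z] leaves the remaining mass. *)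
Lemma Esg_exp_rvec (z : I -> 'rV[C]_r) (l : seq I) (m : 'I_d -> R) :
  uniq l -> (forall k, 0 <= m k) -> (forall k, 8 * m k * mass z l k <= 1) ->
  Esg (fun s => expR (\sum_k m k * nsq (rvec z l k s))) <=
  expR (2 * \sum_k m k * mass z l k).
Proof.
elim: l m => [|a l IH] m.
  move=> _ _ _; rewrite (eq_Esg (g := fun=> 1)) ?Esg_cst; last first.
    by move=> s; rewrite big1 ?expR0 // => k _; rewrite /rvec big_nil nsq0 mulr0.
  by rewrite -expR0 ler_expR mulr_ge0 // sumr_ge0 // => k _; rewrite /mass big_nil mulr0.
rewrite cons_uniq => /andP[nal ul] m0 hm.
set k0 := a.2; pose m' k := m k * (1 + 4 * m k * ((k0 == k)%:R * nsq (z a))).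
have za0 := nsq_ge0 (z a).
have massE k : mass z (a :: l) k = (k0 == k)%:R * nsq (z a) + mass z l k.
  by rewrite /mass big_cons -/k0; case: (k0 == k); rewrite ?mul1r // mul0r add0r.
have m'0 k : 0 <= m' k.
  by rewrite mulr_ge0 // addr_ge0 // !mulr_ge0.
have small k : 8 * m k * mass z l k <= 1.
  apply: le_trans (hm k); rewrite ler_wpM2l ?mulr_ge0 //.
  by rewrite massE lerDr mulr_ge0.
(* The smallness condition gives 4 m M <= 1/2 for the remaining mass M, so enlarging [m] to [m']
   costs at most half of m |z|^2. The factor 2 in the conclusion absorbs this. *)
have key k : m' k * mass z l k <= m k * mass z l k + m k * ((k0 == k)%:R * nsq (z a)) / 2.
  rewrite /m'; have := mass_ge0 z l k; have := small k; have := m0 k.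
  have : 0 <= (k0 == k)%:R * nsq (z a) by rewrite mulr_ge0.
  move: (mass z l k) (m k) (_ * nsq _) => M c y y0 c0 h M0.
  have : 0 <= c * y * (1 - 8 * c * M) by rewrite !mulr_ge0 // subr_ge0.
  by move=> {small hm m0 IH massE m'0 m'}; lra.
have hm' k : 8 * m' k * mass z l k <= 1.
  apply: le_trans (hm k).
  rewrite -[8 * m' k * _]mulrA -[8 * m k * _]mulrA ler_wpM2l //.
  apply: le_trans (key k) _; rewrite massE mulrDr addrC lerD2r.
  by rewrite ler_pdivrMr // ler_peMr ?mulr_ge0 // ler1n.
have hE' := IH m' ul m'0 hm'.
pose E' := Esg (fun s => expR (\sum_k m' k * nsq (rvec z l k s))).
apply: (@le_trans _ _ (expR (m k0 * nsq (z a)) * E')); last first.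
  apply: (@le_trans _ _ (expR (m k0 * nsq (z a)) * expR (2 * \sum_k m' k * mass z l k))).
    by rewrite ler_wpM2l ?expR_ge0.
  rewrite -expRD ler_expR.
  have -> : m k0 * nsq (z a) = \sum_k m k * ((k0 == k)%:R * nsq (z a)).
    rewrite (bigD1 k0) //= eqxx mul1r big1 ?addr0 // => k.
    by rewrite eq_sym => /negPf ->; rewrite mul0r mulr0.
  rewrite !mulr_sumr -big_split ler_sum // => k _ /=.
  by have := key k; rewrite massE; lra.
rewrite /E' -EsgZ; apply: (Esg_flip_le (p := a)) => s.
have rest k : rvec z l k (flip a s) = rvec z l k s.
  rewrite /rvec big_seq_cond [RHS]big_seq_cond; apply: eq_bigr => p /andP[pl _].
  by rewrite flip_other //; apply: contraNneq nal => <-.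
(* [x] is the cross term with the sign at [a]. Averaging gives cosh x <= exp(x^2), and
   Cauchy-Schwarz bounds x^2 by what the increase from [m] to [m'] adds to the exponent. *)
pose w := rvec z l k0 s; pose x : R := 2 * m k0 * complex.Re (ip w (z a)).
pose T := m k0 * nsq (z a) + \sum_k m k * nsq (rvec z l k s).
have val (b : bool) (s' : S) : s' a = b -> (forall k, rvec z l k s' = rvec z l k s) ->
    \sum_k m k * nsq (rvec z (a :: l) k s') = T + sg b * x.
  move=> e hs'; rewrite /T (bigD1 k0) //= [in RHS](bigD1 k0) //=.
  rewrite (eq_bigr (fun k => m k * nsq (rvec z l k s))); last first.
    move=> k nk; rewrite {1}/rvec big_cons -/k0 eq_sym (negPf nk).
    by rewrite -/(rvec z l k s') hs'.
  rewrite {1}/rvec big_cons -/k0 eqxx -/(rvec z l k0 s') hs' -/w nsqD nsqZ.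
  by rewrite sqn_real e sg_sqr ipZl ReZ (Re_ipC w (z a)) /x; ring.
rewrite (val (s a) s) // (val (~~ s a) (flip a s)) ?flip_at //.
apply: (@le_trans _ _ (2 * (expR T * expR (x ^+ 2)))).
  rewrite !(expRD T) -mulrDr [leRHS]mulrCA ler_wpM2l ?expR_ge0 // sgN.
  have := coshR_le x; case: (s a); rewrite /sg /= ?expr0 ?expr1.
    by rewrite opprK mulN1r mul1r addrC.
  by rewrite mulN1r mul1r.
rewrite ler_wpM2l // -!expRD ler_expR /T -addrA lerD2l.
rewrite [leRHS](_ : _ = \sum_k m k * nsq (rvec z l k s) +
    4 * m k0 ^+ 2 * nsq (z a) * nsq w); last first.
  rewrite (bigD1 k0) //= [in RHS](bigD1 k0) //= /m' eqxx mul1r -/w.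
  rewrite (eq_bigr (fun k => m k * nsq (rvec z l k s))); last first.
    by move=> k nk; rewrite eq_sym (negPf nk) mul0r mulr0 addr0 mulr1.
  by ring.
rewrite lerD2l /x.
have := le_trans (Re_sqr_le_sqn _) (cauchy_schwarz w (z a)).
have := sqr_ge0 (m k0).
move: (m k0) (complex.Re _) (nsq w) (nsq (z a)) => c y p q h1 h2.
have := mulr_ge0 h1 (_ : 0 <= p * q - y ^+ 2); rewrite subr_ge0 => /(_ h2).
by lra.
Qed.

End RademacherVectors.

(** * The sign chaos for fixed supports *)

Section Chaos.
Context {R : realType} (n d r : nat).
Local Notation C := R[i].
Local Notation I := ('I_n * 'I_d)%type.
Local Notation S := {ffun I -> bool}.
Context (N : 'I_n -> {set 'I_d}) (v : 'I_n -> 'rV[C]_r).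

Definition row_rank (p : I) : nat := p.1 * d + p.2.
Lemma row_rank_inj : injective row_rank.
Proof.
move=> [i k] [j l]; rewrite /row_rank /= => e.
have dd : (0 < d)%N by apply: leq_ltn_trans (ltn_ord k).
have e1 : i = j.
  apply/val_inj; have := congr1 (divn^~ d) e.
  by rewrite !divnMDl // !divn_small ?addn0.
have e2 : k = l by apply/val_inj; move: e; rewrite e1 => /addnI.
by rewrite e1 e2.
Qed.

Definition zvec (p : I) : 'rV[C]_r := if p.2 \in N p.1 then v p.1 else 0.
Definition before (t : nat) : seq I :=
  seq.filter (fun p : I => (p.1 < t)%N) (enum {: I}).
Definition uvec (p : I) (s : S) : 'rV[C]_r := rvec zvec (before p.1) p.2 s.
(* [\sum_p s p * kmx p s] is [alpha (V^* S S^* V - 1)], where row [i] of the sketch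
   [S] has support [N i] and [v i] is row [i] of [V]; its increments are predictable
   because [uvec] only collects the earlier rows of the same column. *)
Definition kmx (p : I) (s : S) : 'M[C]_r :=
  (zvec p)^t* *m uvec p s + (uvec p s)^t* *m zvec p.

Definition chaos (x : 'rV[C]_r) (s : S) : R :=
  \sum_p sg (s p) * qf (kmx p s) x.

Lemma mem_before t p : (p \in before t) = (p.1 < t)%N.
Proof. by rewrite mem_filter mem_enum andbT. Qed.

Lemma uniq_before t : uniq (before t).
Proof. by rewrite filter_uniq // enum_uniq. Qed.

Lemma rvec_flip l k p s : ~~ ((p \in l) && (p.2 == k)) ->
  rvec zvec l k (flip p s) = rvec zvec l k s.
Proof.
move=> h; rewrite /rvec big_seq_cond [RHS]big_seq_cond.
apply: eq_bigr => q hq; rewrite flip_other //.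
by apply: contraNneq h => <-.
Qed.

Lemma uvec_predictable : predictable row_rank uvec.
Proof.
move=> p q s le_qp; apply: rvec_flip; rewrite mem_before.
apply: contraL le_qp => /andP[lt_pq /eqP e]; rewrite -ltnNge /row_rank e ltn_add2r.
have dd : (0 < d)%N by apply: leq_ltn_trans (ltn_ord p.2).
by rewrite ltn_pmul2r.
Qed.

Lemma kmx_predictable : predictable row_rank kmx.
Proof. by move=> p q s h; rewrite /kmx uvec_predictable. Qed.

Lemma kmx_herm p s : herm (kmx p s).
Proof.
by rewrite /herm linearD /= map_mxD !trmx_mul !map_mxM /= !trmxCK addrC.
Qed.

Lemma mul_kmx x p s : x *m kmx p s =
  ip x (zvec p) *: uvec p s + ip x (uvec p s) *: zvec p.
Proof.
rewrite mulmxDr !mulmxA.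
have h (y : 'rV[C]_r) : x *m y^t* = (ip x y)%:M.
  by rewrite [LHS]mx11_scalar.
by rewrite !h !mul_scalar_mx.
Qed.

Lemma qf_kmx x p s :
  qf (kmx p s) x = 2 * complex.Re (ip x (zvec p) * ip (uvec p s) x).
Proof.
rewrite /qf mul_kmx ipDl !ipZl ReD.
rewrite -[X in _ + complex.Re X](conjCK (_ * _)) rmorphM /= !ip_conj.
by rewrite Re_conjC [ip _ x * _]mulrC; ring.
Qed.

(** The two summands are the two parts of the quadratic variation: the first has weights |u|^2, the
    second is turned into a reweighted martingale by [sum_uvec_weighted]. *)
Lemma nsq_kmx x p s : nsq (x *m kmx p s) <=
  2 * (sqn (ip x (zvec p)) * nsq (uvec p s) +
       sqn (ip x (uvec p s)) * nsq (zvec p)).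
Proof. by rewrite mul_kmx; apply: le_trans (nsqD_le _ _) _; rewrite !nsqZ mulrDr. Qed.

Lemma ip_rvec x l k s : ip x (rvec zvec l k s) =
  \sum_(p <- l | p.2 == k) (sg (s p))%:C%C * ip x (zvec p).
Proof.
by rewrite /rvec ip_sumr; apply: eq_bigr => p _; rewrite ipZr conj_real.
Qed.

Lemma big_before (M : nmodType) (F : I -> M) t k :
  \sum_(p <- before t | p.2 == k) F p = \sum_(i < n | (i < t)%N) F (i, k).
Proof.
rewrite /before big_filter_cond big_enum_cond /=.
rewrite (eq_bigl (fun p : I => (p.1 < t)%N && (p.2 == k))) //.
rewrite (eq_bigr (fun p : I => F (p.1, p.2))) => [|[]//].
rewrite -(pair_big_dep (fun i : 'I_n => (i < t)%N) (fun _ l => l == k)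
  (fun i l => F (i, l))).
by apply: eq_bigr => i _; rewrite big_pred1_eq.
Qed.

Lemma sum_pairs (F : I -> R) : \sum_p F p = \sum_k \sum_i F (i, k).
Proof.
rewrite exchange_big (pair_bigA _ (fun i k => F (i, k))) /=.
by apply: eq_bigr => -[].
Qed.

(* Expanding the square over the rows in increasing order. *)
Lemma sqn_ip_rvec x t k s : sqn (ip x (rvec zvec (before t) k s)) =
  \sum_(i < n | (i < t)%N)
    (sqn (ip x (zvec (i, k))) + sg (s (i, k)) * qf (kmx (i, k) s) x).
Proof.
elim: t => [|t IH].
  rewrite ip_rvec !big_before !big_pred0 // /sqn /=.
  by rewrite expr0n addr0.
have [lt_tn|le_nt] := ltnP t n; last first.
  have same (i : 'I_n) : (i < t.+1)%N = (i < t)%N.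
    by rewrite !(leq_trans (ltn_ord i)) // (leq_trans le_nt).
  rewrite (eq_bigl _ _ same) -IH; congr (sqn (ip x _)).
  by rewrite /rvec !big_before; apply: eq_bigl => i; rewrite same.
pose j := Ordinal lt_tn.
have split (M : nmodType) (F : 'I_n -> M) : \sum_(i < n | (i < t.+1)%N) F i =
    \sum_(i < n | (i < t)%N) F i + F j.
  rewrite (bigD1 j) //= addrC; congr (_ + _); apply: eq_bigl => i.
  by rewrite ltnS -[i != j]/(i != t :> nat) andbC ltn_neqAle.
have -> : rvec zvec (before t.+1) k s =
    rvec zvec (before t) k s + (sg (s (j, k)))%:C%C *: zvec (j, k).
  by rewrite /rvec !big_before split.
rewrite split -IH qf_kmx; change (uvec (j, k) s) with (rvec zvec (before t) k s).
set u := rvec zvec (before t) k s; set z := zvec _; set e := sg _.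
rewrite ipDr ipZr conj_real !sqnE rmorphD rmorphM /= conj_real.
rewrite (ip_conj x u) (ip_conj x z).
have e2 : e * e = 1 by rewrite -expr2 sg_sqr.
move: (ip_conj x u) (ip_conj x z) => <- <-.
case: (ip x u) => a b; case: (ip x z) => a' b' /=.
by ring: e2.
Qed.

Definition after_mass (p : I) : R :=
  \sum_(j < n | (p.1 < j)%N) nsq (zvec (j, p.2)).

Lemma after_mass_ge0 p : 0 <= after_mass p.
Proof. by apply: sumr_ge0 => j _; apply: nsq_ge0. Qed.

Definition col_mass k : R := \sum_i nsq (zvec (i, k)).

Lemma after_mass_le p : after_mass p <= col_mass p.2.
Proof.
rewrite /col_mass /after_mass [leRHS](bigID (fun j : 'I_n => (p.1 < j)%N)) /=.
by rewrite lerDl sumr_ge0 // => j _; apply: nsq_ge0.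
Qed.

Lemma before_mass_le t k : mass zvec (before t) k <= col_mass k.
Proof.
rewrite /mass big_before /col_mass.
rewrite [leRHS](bigID (fun j : 'I_n => (j < t)%N)) /=.
by rewrite lerDl sumr_ge0 // => j _; apply: nsq_ge0.
Qed.

(** Each square is expanded over the earlier rows and the sums are exchanged: a row then collects
    the masses of all later rows in its column. The random part has the increments of [chaos],
    reweighted. *)
Lemma sum_uvec_weighted x s :
  \sum_p sqn (ip x (uvec p s)) * nsq (zvec p) =
  \sum_p after_mass p * sqn (ip x (zvec p)) +
  \sum_p sg (s p) * (after_mass p * qf (kmx p s) x).
Proof.
pose g (p : I) : R := sqn (ip x (zvec p)) + sg (s p) * qf (kmx p s) x.
transitivity (\sum_p after_mass p * g p); last first.
  rewrite -big_split; apply: eq_bigr => p _ /=.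
  by rewrite /g mulrDr; congr (_ + _); rewrite mulrCA.
rewrite !sum_pairs; apply: eq_bigr => k _ /=.
under eq_bigr => j _ do rewrite sqn_ip_rvec -/(g _) mulr_suml.
under [RHS]eq_bigr => i _ do rewrite /after_mass mulr_suml.
rewrite (exchange_big_dep xpredT) //=; apply: eq_bigr => i _.
by apply: eq_bigr => j _; rewrite mulrC.
Qed.

(** Diagonal terms count the support of each row, off-diagonal terms form the chaos. With supports
    of size alpha and a frame, the first sum is alpha |x|^2. *)
Lemma sum_sqn_cols x s :
  \sum_k sqn (ip x (rvec zvec (before n) k s)) =
  \sum_i #|N i|%:R * sqn (ip x (v i)) + chaos x s.
Proof.
rewrite (eq_bigr (fun k => \sum_i (sqn (ip x (zvec (i, k))) +
          sg (s (i, k)) * qf (kmx (i, k) s) x))); last first.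
  move=> k _; rewrite sqn_ip_rvec; apply: eq_bigl => i; exact: ltn_ord.
rewrite exchange_big /chaos sum_pairs [X in _ + X]exchange_big.
rewrite -big_split; apply: eq_bigr => i _ /=; rewrite big_split; congr (_ + _).
rewrite (bigID (mem (N i))) /= addrC big1 ?add0r; last first.
  move=> k /negPf h; rewrite /zvec /= h ip0r /sqn /= expr0n addr0.
  by [].
rewrite (eq_bigr (fun=> sqn (ip x (v i)))) => [|k h]; last by rewrite /zvec /= h.
by rewrite sumr_const mulr_natl.
Qed.

Definition overlap j : R :=
  \sum_(i | i != j) nsq (v i) * #|N i :&: N j|%:R.
(* The weights [nsq (v j)] sum to [r], so Markov's inequality for this moment costs
   no union bound over the [n] rows. *)
Definition overlap_moment : R := \sum_j nsq (v j) * expR (overlap j).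

Lemma nsq_zvec p : nsq (zvec p) = (p.2 \in N p.1)%:R * nsq (v p.1).
Proof. by rewrite /zvec; case: ifP; rewrite ?mul1r // nsq0 mul0r. Qed.

Lemma overlapE j : overlap j =
  \sum_(k in N j) \sum_(i | i != j) nsq (zvec (i, k)).
Proof.
rewrite exchange_big; apply: eq_bigr => i _ /=.
under eq_bigr do rewrite nsq_zvec /=.
rewrite -mulr_suml mulrC; congr (_ * _).
rewrite -natr_sum; congr (_%:R).
rewrite -sum1_card big_mkcond [RHS]big_mkcond; apply: eq_bigr => k _.
by rewrite inE; case: (k \in N i); case: (k \in N j).
Qed.

Lemma after_mass_overlap j :
  \sum_(k in N j) after_mass (j, k) <= overlap j.
Proof.
rewrite overlapE ler_sum // => k _; rewrite /after_mass /=.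
rewrite [leRHS](bigID (fun i : 'I_n => (j < i)%N)) /=.
rewrite -[leLHS]addr0 lerD ?sumr_ge0 // => [|i _]; last exact: nsq_ge0.
rewrite le_eqVlt; apply/orP; left; apply/eqP; apply: eq_bigl => i.
by case: ltnP => h; rewrite ?andbF // andbT; apply/esym; apply: contraTneq h => ->; rewrite ltnn.
Qed.

Lemma before_mass_overlap j :
  \sum_(k in N j) mass zvec (before j) k <= overlap j.
Proof.
rewrite overlapE ler_sum // => k _; rewrite /mass big_before.
rewrite [leRHS](bigID (fun i : 'I_n => (i < j)%N)) /=.
rewrite -[leLHS]addr0 lerD ?sumr_ge0 // => [|i _]; last exact: nsq_ge0.
rewrite le_eqVlt; apply/orP; left; apply/eqP; apply: eq_bigl => i.
by case: ltnP => h; rewrite ?andbF // andbT; apply/esym; apply: contraTneq h => ->; rewrite ltnn.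
Qed.

(** Equivalently, the matrix with rows [v i] has orthonormal columns. *)
Hypothesis frame : forall x : 'rV[C]_r, \sum_i sqn (ip x (v i)) = nsq x.

Lemma frame_nsq_le1 j : nsq (v j) <= 1.
Proof.
have := frame (v j); rewrite (bigD1 j) //= => e.
have h : sqn (ip (v j) (v j)) <= nsq (v j).
  by rewrite -e lerDl sumr_ge0 // => i _; apply: sqn_ge0.
have := le_trans (Re_sqr_le_sqn _) h; rewrite -/(nsq (v j)).
have := nsq_ge0 (v j); move: (nsq _) => y y0 hy.
by rewrite leNgt; apply/negP => y1; nra.
Qed.

(** A trace: the frame identity is summed over the standard basis. *)
Lemma frame_sum_nsq : \sum_i nsq (v i) = r%:R.
Proof.
under eq_bigr do rewrite nsqE.
rewrite exchange_big -[in RHS](card_ord r) -sumr_const; apply: eq_bigr => l _ /=.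
have d1 k : (delta_mx 0 l : 'rV[C]_r) 0 k = (k == l)%:R by rewrite mxE eqxx.
have <- : nsq (delta_mx 0 l : 'rV[C]_r) = 1.
  rewrite nsqE (bigD1 l) //= big1 => [|k h].
    by rewrite d1 eqxx addr0 -[true%:R]/(1%:C%C) sqn_real expr1n.
  by rewrite d1 (negPf h) /sqn /= expr0n addr0.
rewrite -frame.
apply: eq_bigr => i _; rewrite ipE (bigD1 l) //= big1 => [|k h].
  by rewrite d1 eqxx mul1r addr0 sqn_conj.
by rewrite d1 (negPf h) mul0r.
Qed.

Lemma overlap_ge0 j : 0 <= overlap j.
Proof. by apply: sumr_ge0 => i _; rewrite mulr_ge0 ?nsq_ge0. Qed.

Lemma overlap_moment_ge : r%:R <= overlap_moment.
Proof.
rewrite -frame_sum_nsq /overlap_moment ler_sum // => i _.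
by rewrite ler_peMr ?nsq_ge0 // -expR0 ler_expR overlap_ge0.
Qed.

(* A bucket of mass [S] contributes at least [S exp (S - 1)] to the moment. *)
Lemma col_mass_le k : (0 < r)%N -> col_mass k <= ln overlap_moment + 1.
Proof.
move=> r0; have P1 : 1 <= overlap_moment.
  by apply: le_trans overlap_moment_ge; rewrite ler1n.
have [le1|gt1] := leP (col_mass k) 1.
  by apply: le_trans le1 _; rewrite lerDr ln_ge0.
rewrite -lerBlDr -ler_expR lnK ?posrE ?(lt_le_trans _ P1) //.
apply: (@le_trans _ _ (col_mass k * expR (col_mass k - 1))).
  by rewrite ler_peMl ?expR_ge0 // ltW.
rewrite {1}/col_mass mulr_suml /overlap_moment ler_sum // => j _.
rewrite nsq_zvec /=; case: (boolP (k \in N j)) => kj; last first.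
  by rewrite mul0r mul0r mulr_ge0 ?nsq_ge0 ?expR_ge0.
rewrite mul1r ler_wpM2l ?nsq_ge0 // ler_expR.
rewrite overlapE (bigD1 k) //= -[leLHS]addr0 lerD //; last first.
  by apply: sumr_ge0 => l _; apply: sumr_ge0 => i _; apply: nsq_ge0.
rewrite /col_mass (bigD1 j) //= lerBlDr addrC lerD2l.
by rewrite nsq_zvec /= kj mul1r frame_nsq_le1.
Qed.

(** The counterpart of [overlap_moment] once the signs are drawn. The factor (8 lam)^-1 is the
    largest that [Esg_exp_rvec] admits for columns of mass up to [lam]. *)
Definition uvec_moment (lam : R) (s : S) : R :=
  \sum_j nsq (v j) *
    expR (\sum_(k in N j) (8 * lam)^-1 * nsq (uvec (j, k) s)).

Lemma Esg_uvec_moment lam : 1 <= lam -> (forall k, col_mass k <= lam) ->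
  Esg (uvec_moment lam) <= overlap_moment.
Proof.
move=> l1 hl; have l0 : 0 < lam by apply: lt_le_trans l1.
rewrite /uvec_moment Esg_sum ler_sum // => j _; rewrite EsgZ.
rewrite ler_wpM2l ?nsq_ge0 //.
pose m (k : 'I_d) : R := (k \in N j)%:R * (8 * lam)^-1.
have m0 k : 0 <= m k by rewrite mulr_ge0 // invr_ge0 mulr_ge0 // ltW.
have mle k : m k * (8 * lam) <= 1.
  by rewrite /m -mulrA mulVf ?mulr1 ?gt_eqF ?mulr_gt0 // lern1 leq_b1.
have hm k : 8 * m k * mass zvec (before j) k <= 1.
  apply: le_trans (mle k); rewrite [8 * m k]mulrC -mulrA ler_wpM2l // ler_wpM2l //.
  exact: le_trans (before_mass_le _ _) (hl k).
have := Esg_exp_rvec (uniq_before j) m0 hm.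
have cond (f : 'I_d -> R) : \sum_k m k * f k = \sum_(k in N j) (8 * lam)^-1 * f k.
  rewrite [RHS]big_mkcond; apply: eq_bigr => k _; rewrite /m.
  by case: (k \in N j); rewrite ?mul1r // !mul0r.
under eq_Esg do rewrite cond.
move/le_trans; apply; rewrite ler_expR cond -mulr_sumr.
(* The exponent is now the mass divided by 4 lam, at most the overlap because [1 <= lam]. *)
apply: le_trans (before_mass_overlap j); rewrite mulrA.
rewrite ler_piMl //; first by apply: sumr_ge0 => k _; apply: mass_ge0.
by rewrite invfM mulrA ler_pdivrMr // mul1r; lra.
Qed.

End Chaos.

(** [W] returns only a quarter of [Q], hence half after doubling, which is absorbed on the left: 2
    (32 + 2 + 16) = 100. *)
Lemma variation_le (R : realFieldType) (lam Q W : R) : 1 <= lam ->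
  W <= Q / 4 + 8 * lam ^+ 3 -> Q <= 2 * (16 * lam ^+ 2 + (lam + W)) ->
  Q <= 100 * lam ^+ 3.
Proof.
move=> lam1.
have l23 : lam ^+ 2 <= lam ^+ 3 by rewrite ler_weXn2l.
have l13 : lam <= lam ^+ 3 by rewrite -[leLHS]expr1 ler_weXn2l.
lra.
Qed.

(** After multiplication by [lam], the variation contributes 2 * 100 and the logarithm of the trace
    1, in units of lam^2. *)
Lemma chaos_ge_arith (R : realFieldType) (lam Q X : R) : 1 <= lam ->
  Q <= 100 * lam ^+ 3 -> - lam^-1 * X <= 2 * (lam^-1 ^+ 2 * Q) + lam ->
  - (201 * lam ^+ 2) <= X.
Proof.
move=> lam1 hQ h; have lam0 : 0 < lam by apply: lt_le_trans lam1.
have lz := gt_eqF lam0.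
have : lam * (- lam^-1 * X) <= lam * (2 * (lam^-1 ^+ 2 * Q) + lam).
  by rewrite ler_pM2l.
have -> : lam * (- lam^-1 * X) = - X by field; rewrite lz.
have -> : lam * (2 * (lam^-1 ^+ 2 * Q) + lam) = 2 * (Q / lam) + lam ^+ 2.
  by field; rewrite lz.
have : Q / lam <= 100 * lam ^+ 2 by rewrite ler_pdivrMr // -mulrA -exprSr.
lra.
Qed.

Lemma ge1_of3 (R : realFieldType) (a b c : R) : 0 <= a -> 0 <= b -> 0 <= c ->
  [|| 1 <= a, 1 <= b | 1 <= c] -> 1 <= a + b + c.
Proof. by move=> a0 b0 c0 /or3P[] h; lra. Qed.

(** * Lower tail of the chaos, uniformly over unit vectors *)

Section ChaosTail.
Context {R : realType} (n d r : nat).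
Local Notation C := R[i].
Local Notation I := ('I_n * 'I_d)%type.
Local Notation S := {ffun I -> bool}.
Context (N : 'I_n -> {set 'I_d}) (v : 'I_n -> 'rV[C]_r).

(** A constant [c] tests the chaos itself; [c] proportional to [after_mass] tests the random part of
    its variation. *)
Definition chaos_trexp (c : I -> R) (s : S) : R :=
  trexp (\sum_p ((sg (s p))%:C%C *: ((c p)%:C%C *: kmx N v p s) -
    2%:C%C *: (((c p)%:C%C *: kmx N v p s) *m ((c p)%:C%C *: kmx N v p s)))).

Lemma Esg_chaos_trexp c : Esg (chaos_trexp c) <= r%:R.
Proof.
apply: (trexp_supermartingale (@row_rank_inj n d)) => [p q s h|p s].
  by rewrite kmx_predictable.
by apply: hermZ; apply: kmx_herm.
Qed.

Lemma chaos_trexp_ge (c : I -> R) (x : 'rV[C]_r) (s : S) : nsq x = 1 ->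
  \sum_p sg (s p) * (c p * qf (kmx N v p s) x) <=
  2 * (\sum_p c p ^+ 2 * nsq (x *m kmx N v p s)) + ln (chaos_trexp c s).
Proof.
move=> x1; rewrite -lerBlDl.
apply: le_trans (expR_qf_le_trexp (n := r) (x := x) _ x1); last first.
  apply: herm_sum => p; apply: hermD; first by do 2!apply: hermZ; apply: kmx_herm.
  by apply/hermN/hermZ/herm_sqr/hermZ/kmx_herm.
rewrite qf_sum mulr_sumr -sumrB ler_sum // => p _.
rewrite [leRHS]qfD qfN !qfZ qf_sqr; last by apply/hermZ/kmx_herm.
by rewrite -scalemxAr nsqZ sqn_real.
Qed.

Hypothesis frame : forall x : 'rV[C]_r, \sum_i sqn (ip x (v i)) = nsq x.
Hypothesis r_gt0 : (0 < r)%N.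
Context (lam eta : R).
Hypothesis lam1 : 1 <= lam.
Hypothesis eta_gt0 : 0 < eta.
Hypothesis lam_moment : ln (overlap_moment N v) + 1 <= lam.
Hypothesis lam_eta : ln (overlap_moment N v / eta) + 1 <= 2 * lam.
Hypothesis lam_r : ln (r%:R / eta) <= lam.

Let lam0 : 0 < lam. Proof. exact: lt_le_trans lam1. Qed.

Let sum_zvec (F : I -> R) x :
  \sum_p sqn (ip x (zvec N v p)) * F p =
  \sum_j sqn (ip x (v j)) * \sum_(k in N j) F (j, k).
Proof.
rewrite sum_pairs exchange_big; apply: eq_bigr => j _ /=.
rewrite mulr_sumr [RHS]big_mkcond; apply: eq_bigr => k _.
by rewrite /zvec /=; case: ifP => // _; rewrite ip0r /sqn /= expr0n addr0 mul0r.
Qed.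

Let w_le x j : nsq x = 1 -> sqn (ip x (v j)) <= nsq (v j).
Proof. by move=> x1; have := cauchy_schwarz x (v j); rewrite x1 mul1r. Qed.

Let moment_gt0 : 0 < overlap_moment N v.
Proof. by apply: lt_le_trans (overlap_moment_ge _ frame); rewrite ltr0n. Qed.

Let uvec_moment_gt0 s : 0 < uvec_moment N v lam s.
Proof.
have h : r%:R <= uvec_moment N v lam s.
  rewrite -(frame_sum_nsq frame) ler_sum // => j _.
  rewrite ler_peMr ?nsq_ge0 // -expR0 ler_expR sumr_ge0 // => k _.
  by rewrite mulr_ge0 ?nsq_ge0 // invr_ge0 mulr_ge0 // ltW.
by apply: lt_le_trans h; rewrite ltr0n.
Qed.

(** [wsum_le_ln] with weights |<x, v_j>|^2: the logarithm plus 1 is at most 2 lam and the exponents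
    carry the factor (8 lam)^-1, whence 16 lam^2. *)
Let first_variation x s : nsq x = 1 ->
  uvec_moment N v lam s <= overlap_moment N v / eta ->
  \sum_p sqn (ip x (zvec N v p)) * nsq (uvec N v p s) <= 16 * lam ^+ 2.
Proof.
move=> x1 hm; rewrite (sum_zvec (fun p => nsq (uvec N v p s))).
have := @wsum_le_ln R 'I_n (fun j => sqn (ip x (v j))) (fun j => nsq (v j))
  (fun j => \sum_(k in N j) (8 * lam)^-1 * nsq (uvec N v (j, k) s))
  (fun j => sqn_ge0 _) (fun j => w_le j x1).
rewrite frame x1 -/(uvec_moment N v lam s) => /(_ erefl) h.
have h2 : ln (uvec_moment N v lam s) <= ln (overlap_moment N v / eta).
  by rewrite ler_ln ?posrE ?divr_gt0.
have l8 : 0 < 8 * lam by rewrite mulr_gt0.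
rewrite -(ler_pM2l (_ : 0 < (8 * lam)^-1)) ?invr_gt0 //.
apply: (@le_trans _ _ (2 * lam)); last first.
  by rewrite ler_pdivlMl //; lra.
have {}h2 : ln (uvec_moment N v lam s) + 1 <= 2 * lam.
  by apply: le_trans lam_eta; rewrite lerD2r.
apply: le_trans (le_trans h h2).
rewrite mulr_sumr ler_sum // => j _; rewrite mulrCA ler_wpM2l ?sqn_ge0 //.
by rewrite mulr_sumr.
Qed.

Let zbar_le x : nsq x = 1 ->
  \sum_p after_mass N v p * sqn (ip x (zvec N v p)) <= lam.
Proof.
move=> x1; under eq_bigr do rewrite mulrC.
rewrite (sum_zvec (fun p => after_mass N v p)); apply: le_trans lam_moment.
apply: (@le_trans _ _ (\sum_j sqn (ip x (v j)) * overlap N v j)); last first.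
  have h := @wsum_le_ln R 'I_n (fun j => sqn (ip x (v j))) (fun j => nsq (v j))
    (overlap N v) (fun j => sqn_ge0 _) (fun j => w_le j x1).
  by apply: h; rewrite frame.
by rewrite ler_sum // => j _; rewrite ler_wpM2l ?sqn_ge0 // after_mass_overlap.
Qed.

(** The negative sign of [theta1] produces a lower tail. As [after_mass] is at most [lam], [theta2]
    is at most (8 lam)^-1, so its compensator returns only Q / 4. *)
Let theta1 : R := - lam^-1.
Let theta2 (p : I) : R := (8 * lam ^+ 2)^-1 * after_mass N v p.

Let chaos_ge x s : nsq x = 1 ->
  uvec_moment N v lam s <= overlap_moment N v / eta ->
  chaos_trexp (fun=> theta1) s <= r%:R / eta ->
  chaos_trexp theta2 s <= r%:R / eta ->
  - (201 * lam ^+ 2) <= chaos N v x s.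
Proof.
move=> x1 hu h1 h2.
have reta : 0 < r%:R / eta by rewrite divr_gt0 ?ltr0n.
have pos c : 0 < chaos_trexp c s by apply: trexp_gt0.
have ln_le c : chaos_trexp c s <= r%:R / eta -> ln (chaos_trexp c s) <= lam.
  by move=> h; apply: le_trans lam_r; rewrite ler_ln ?posrE.
have k1 := chaos_trexp_ge (fun=> theta1) s x1.
have k2 := chaos_trexp_ge theta2 s x1.
have {h1}l1 := ln_le _ h1; have {h2}l2 := ln_le _ h2.
set Q := \sum_p nsq (x *m kmx N v p s).
set W := \sum_p sg (s p) * (after_mass N v p * qf (kmx N v p s) x).
have Q0 : 0 <= Q by apply: sumr_ge0 => p _; apply: nsq_ge0.
have lz := gt_eqF lam0; have lge0 := ltW lam0.
have {k2}hW : W <= Q / 4 + 8 * lam ^+ 3.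
  have e : \sum_p sg (s p) * (theta2 p * qf (kmx N v p s) x) = (8 * lam ^+ 2)^-1 * W.
    by rewrite mulr_sumr; apply: eq_bigr => p _; rewrite /theta2; ring.
  have h : \sum_p theta2 p ^+ 2 * nsq (x *m kmx N v p s) <= Q / (64 * lam ^+ 2).
    rewrite mulrC mulr_sumr ler_sum // => p _; rewrite ler_wpM2r ?nsq_ge0 //.
    have -> : (64 * lam ^+ 2)^-1 = ((8 * lam ^+ 2)^-1 * lam) ^+ 2 by field; rewrite lz.
    rewrite ler_pXn2r ?nnegrE ?mulr_ge0 ?after_mass_ge0 ?invr_ge0 ?mulr_ge0 ?sqr_ge0 //.
    rewrite ler_wpM2l ?invr_ge0 ?mulr_ge0 ?sqr_ge0 //.
    by apply: le_trans (after_mass_le _ _ _) (le_trans _ lam_moment); apply: col_mass_le.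
  have l8 : 0 < 8 * lam ^+ 2 by rewrite mulr_gt0 ?exprn_gt0.
  rewrite -(ler_pM2l (_ : 0 < (8 * lam ^+ 2)^-1)) ?invr_gt0 // -e.
  apply: le_trans k2 _.
  have -> : (8 * lam ^+ 2)^-1 * (Q / 4 + 8 * lam ^+ 3) = 2 * (Q / (64 * lam ^+ 2)) + lam.
    by field; rewrite lz.
  by rewrite lerD // ler_wpM2l.
have hF := first_variation x1 hu; have hz := zbar_le x1.
(* Both parts of the variation: 16 lam^2 for the first; for the second, [lam] for the deterministic
   matrix plus the martingale [W]. *)
have hQ : Q <= 2 * (16 * lam ^+ 2 + (lam + W)).
  apply: (@le_trans _ _ (\sum_p 2 * (sqn (ip x (zvec N v p)) * nsq (uvec N v p s) +
       sqn (ip x (uvec N v p s)) * nsq (zvec N v p)))).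
    by apply: ler_sum => p _; apply: nsq_kmx.
  rewrite -mulr_sumr ler_wpM2l // big_split lerD //=.
  by rewrite sum_uvec_weighted lerD2r.
have Q100 := variation_le lam1 hW hQ.
have e1 : \sum_p sg (s p) * (theta1 * qf (kmx N v p s) x) = - lam^-1 * chaos N v x s.
  by rewrite mulr_sumr; apply: eq_bigr => p _; rewrite mulrCA.
have e2 : \sum_p theta1 ^+ 2 * nsq (x *m kmx N v p s) = lam^-1 ^+ 2 * Q.
  by rewrite -mulr_sumr /theta1 sqrrN.
rewrite e1 e2 in k1; apply: (chaos_ge_arith lam1 Q100).
exact: le_trans k1 (lerD (lexx _) l1).
Qed.

(** Markov's inequality for [uvec_moment] and for the trace exponentials with [theta1] and [theta2],
    at cost [eta] each. Off these events [chaos_ge] covers all unit vectors. *)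
Lemma chaos_lower_tail :
  Esg (fun s => `[< exists2 x, nsq x = 1 & chaos N v x s < - (201 * lam ^+ 2) >]%:R)
  <= 3 * eta.
Proof.
have reta : 0 < r%:R / eta by rewrite divr_gt0 ?ltr0n.
have peta : 0 < overlap_moment N v / eta by rewrite divr_gt0.
have pos c s : 0 <= chaos_trexp c s by apply/ltW/trexp_gt0.
have posu s : 0 <= uvec_moment N v lam s := ltW (uvec_moment_gt0 s).
have i1 (s : S) : `[< exists2 x, nsq x = 1 & chaos N v x s < - (201 * lam ^+ 2) >]%:R
    <= 1 :> R by rewrite lern1 leq_b1.
have fu s : 0 <= uvec_moment N v lam s / (overlap_moment N v / eta).
  by rewrite divr_ge0 ?(posu s) ?(ltW peta).
have fc c s : 0 <= chaos_trexp c s / (r%:R / eta).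
  by rewrite divr_ge0 ?(pos c s) ?(ltW reta).
pose f s := uvec_moment N v lam s / (overlap_moment N v / eta) +
  chaos_trexp (fun=> theta1) s / (r%:R / eta) + chaos_trexp theta2 s / (r%:R / eta).
apply: (@le_trans _ _ (Esg f)).
  apply: Esg_le => s; rewrite /f.
  have [u1|u1] := leP (uvec_moment N v lam s) (overlap_moment N v / eta); last first.
    apply: le_trans (i1 s) (ge1_of3 (fu s) (fc _ s) (fc _ s) _).
    by apply/or3P; constructor 1; rewrite ler_pdivlMr // mul1r ltW.
  have [h1|h1] := leP (chaos_trexp (fun=> theta1) s) (r%:R / eta); last first.
    apply: le_trans (i1 s) (ge1_of3 (fu s) (fc _ s) (fc _ s) _).
    by apply/or3P; constructor 2; rewrite ler_pdivlMr // mul1r ltW.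
  have [h2|h2] := leP (chaos_trexp theta2 s) (r%:R / eta); last first.
    apply: le_trans (i1 s) (ge1_of3 (fu s) (fc _ s) (fc _ s) _).
    by apply/or3P; constructor 3; rewrite ler_pdivlMr // mul1r ltW.
  have -> : `[< exists2 x, nsq x = 1 & chaos N v x s < - (201 * lam ^+ 2) >] = false.
    apply/asboolPn => -[x x1]; apply/negP; rewrite -leNgt.
    exact: chaos_ge x1 u1 h1 h2.
  exact: addr_ge0 (addr_ge0 (fu s) (fc _ s)) (fc _ s).
have E c : Esg (fun s => chaos_trexp c s / (r%:R / eta)) <= eta.
  under eq_Esg do rewrite mulrC.
  rewrite EsgZ mulrC ler_pdivrMr // mulrC divfK ?gt_eqF //.
  exact: Esg_chaos_trexp.
have Eu : Esg (fun s => uvec_moment N v lam s / (overlap_moment N v / eta)) <= eta.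
  under eq_Esg do rewrite mulrC.
  rewrite EsgZ mulrC ler_pdivrMr // mulrC divfK ?gt_eqF //.
  apply: Esg_uvec_moment => // k.
  by apply: le_trans lam_moment; apply: col_mass_le.
have -> : 3 * eta = eta + eta + eta by ring.
by rewrite /f !EsgD; exact: lerD (lerD Eu (E _)) (E _).
Qed.

End ChaosTail.

(** * Anticoncentration of the chaos at a fixed vector *)

Section ChaosAnticoncentration.
Context {R : realType} (n d r : nat).
Local Notation C := R[i].
Local Notation I := ('I_n * 'I_d)%type.
Local Notation S := {ffun I -> bool}.
Context (N : 'I_n -> {set 'I_d}) (v : 'I_n -> 'rV[C]_r) (x : 'rV[C]_r).

Let lin (p q : I) : R := if (q.2 == p.2) && (q.1 < p.1)%N then
  2 * complex.Re (ip x (zvec N v p) * ip (zvec N v q) x) else 0.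

Let qf_kmx_linear p (s : S) :
  qf (kmx N v p s) x = \sum_q sg (s q) * lin p q.
Proof.
rewrite qf_kmx -[ip (uvec _ _ _ _) x]ip_conj ip_rvec rmorph_sum /=.
rewrite mulr_sumr Re_sum mulr_sumr /before big_filter_cond big_enum_cond /=.
rewrite big_mkcond; apply: eq_bigr => q _; rewrite /lin andbC.
case: ifP => _; last by rewrite mulr0.
by rewrite rmorphM /= conj_real ip_conj mulrCA ReZ mulrCA.
Qed.

(** Bonami's inequality twice: each increment is linear in the earlier signs (constant 9), and the
    chaos is a sum of signs times increments (constant 81). *)
Lemma chaos_anticoncentration :
  180^-1 <= Esg (fun s => (0 <= chaos N v x s)%R%:R) :> R.
Proof.
have pred : predictable (@row_rank n d) (fun p s => qf (kmx N v p s) x).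
  by move=> p q s h; rewrite kmx_predictable.
apply: Esg_anticoncentration.
  exact: (Esg_martingale0 pred).
have -> : 81 = 9 * 9 :> R by ring.
apply: (Esg_bonami (@row_rank_inj n d) _ pred) => // p.
have e j : Esg (fun s => qf (kmx N v p s) x ^+ j) =
    Esg (fun s => (\sum_q sg (s q) * lin p q) ^+ j).
  by apply: eq_Esg => s; rewrite qf_kmx_linear.
rewrite !e -[X in _ <= X * _](mulr1 9).
apply: (Esg_bonami (@row_rank_inj n d) (a := fun q _ => lin p q)) => // q.
by rewrite !Esg_cst mul1r -exprM.
Qed.

End ChaosAnticoncentration.

(** * Random row supports *)

Section RowSupports.
Context {R : realType} (n d : nat).
Local Notation B := {ffun 'I_n -> {set 'I_d}}.
Context (q : {set 'I_d} -> R) (rho : R) (alpha : nat).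
Hypothesis q_ge0 : forall b, 0 <= q b.
Hypothesis rho_ge0 : 0 <= rho.
Hypothesis q_superset : forall U : {set 'I_d},
  \sum_(b : {set 'I_d} | U \subset b) q b <= rho ^+ #|U|.
Hypothesis q_card : forall b, q b != 0 -> (#|b| <= alpha)%N.

Definition Epos (f : B -> R) : R := \sum_(b : B) (\prod_i q (b i)) * f b.

Lemma Epos_le f g : (forall b, f b <= g b) -> Epos f <= Epos g.
Proof.
by move=> h; apply: ler_sum => b _; rewrite ler_wpM2l // prodr_ge0.
Qed.

Lemma Epos_sum (J : Type) (r : seq J) (F : J -> B -> R) :
  Epos (fun b => \sum_(j <- r) F j b) = \sum_(j <- r) Epos (F j).
Proof.
rewrite /Epos exchange_big; apply: eq_bigr => b _.
by rewrite mulr_sumr.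
Qed.

Lemma EposZ a f : Epos (fun b => a * f b) = a * Epos f.
Proof. by rewrite /Epos mulr_sumr; apply: eq_bigr => b _; rewrite mulrCA. Qed.

Lemma sum_q_le1 : \sum_b q b <= 1.
Proof.
have := q_superset finset.set0; rewrite cards0 expr0; apply: le_trans.
by rewrite le_eqVlt; apply/orP; left; apply/eqP; apply: eq_bigl => b; rewrite finset.sub0set.
Qed.

(* Both SJLT constructions enter the argument only through [q_superset], a form of
   negative correlation of the events [k \in b]. *)
Lemma sum_q_prod (t : 'I_d -> R) : (forall k, 0 <= t k) ->
  \sum_b q b * \prod_k (1 + t k * (k \in b)%:R) <= \prod_k (1 + t k * rho).
Proof.
move=> t0.
(* Expansion over subsets U: the product of indicators over U is the event that b contains U, to
   which [q_superset] applies. *)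
have exp (x : 'I_d -> R) : \prod_k (1 + t k * x k) =
    \sum_(U : {set 'I_d}) (\prod_(k in U) t k) * \prod_(k in U) x k.
  under eq_bigr do rewrite addrC.
  rewrite bigA_distr /=; apply: eq_bigr => U _.
  by rewrite -big_split /= [RHS]big_mkcond.
under [leLHS]eq_bigr => b _ do rewrite (exp (fun k => (k \in b)%:R)) mulr_sumr.
rewrite exchange_big (exp (fun=> rho)) /=; apply: ler_sum => U _.
rewrite prodr_const.
apply: (@le_trans _ _ ((\prod_(k in U) t k) * \sum_(b : {set 'I_d} | U \subset b) q b)).
  rewrite mulr_sumr [leRHS]big_mkcond /=; apply: ler_sum => b _.
  case: ifP => [Ub|/negbT/subsetPn[k kU kb]].
    rewrite [X in _ * (_ * X)]big1 ?mulr1 1?mulrC // => k kU.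
    by rewrite (fintype.subsetP Ub).
  by rewrite [X in _ * (_ * X)](bigD1 k) //= (negPf kb) !(mul0r, mulr0).
by rewrite ler_wpM2l ?q_superset // prodr_ge0.
Qed.

Lemma Epos_prod (F : 'I_n -> {set 'I_d} -> R) :
  Epos (fun b => \prod_i F i (b i)) = \prod_i \sum_c q c * F i c.
Proof.
by rewrite bigA_distr_bigA; apply: eq_bigr => b _; rewrite -big_split.
Qed.

Lemma Epos_col_count (k : 'I_d) (t : R) : 0 <= t ->
  Epos (fun b => (1 + t) ^+ (\sum_i (k \in b i))) <= expR (t * (n%:R * rho)).
Proof.
move=> t0.
have -> : Epos (fun b => (1 + t) ^+ (\sum_i (k \in b i))) =
    Epos (fun b => \prod_i (1 + t) ^+ (k \in b i)).
  by apply: eq_bigr => b _; rewrite expr_sum.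
rewrite (Epos_prod (fun _ c => (1 + t) ^+ (k \in c))).
apply: (@le_trans _ _ (\prod_(i < n) expR (t * rho))); last first.
  by rewrite prodr_const card_ord -expRM_natl mulrCA.
apply: ler_prod => i _; rewrite sumr_ge0 /=; last first.
  by move=> c _; rewrite mulr_ge0 // exprn_ge0 // addr_ge0.
apply: le_trans (expR_ge1Dx _).
have := @sum_q_prod (fun l => (l == k)%:R * t) (fun l => mulr_ge0 (ler0n _ _) t0).
have one (x : 'I_d -> R) : \prod_l (1 + (l == k)%:R * t * x l) = 1 + t * x k.
  rewrite (bigD1 k) //= eqxx mul1r big1 ?mulr1 // => l /negPf ->.
  by rewrite !mul0r addr0.
rewrite (one (fun=> rho)); apply: le_trans; apply: ler_sum => c _.
by rewrite (one (fun l => (l \in c)%:R)); case: (k \in c); rewrite /= ?mulr1 ?mulr0 ?addr0 ?expr1 ?expr0 ?mulr1.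
Qed.

(** Chernoff's bound with exponent 2: with mu = [n%:R * rho], -2 M + (e^2 - 1) mu <= -L follows from
    e^2 mu <= M and L - mu <= M. This is the source of the maximum in the theorem. *)
Lemma Epos_col_count_tail (k : 'I_d) (M L : R) :
  expR 2 * (n%:R * rho) <= M -> L - n%:R * rho <= M ->
  Epos (fun b => (M < (\sum_i (k \in b i))%:R)%R%:R) <= expR (- L).
Proof.
move=> h1 h2.
have e1 : 1 <= expR 2 :> R by rewrite -expR0 ler_expR.
have t0 : 0 <= expR 2 - 1 :> R by rewrite subr_ge0.
have := @Epos_col_count k (expR 2 - 1) t0; rewrite subrKC => h.
apply: (@le_trans _ _ (expR (- (2 * M)) *
    Epos (fun b => expR 2 ^+ (\sum_i (k \in b i))))).
  rewrite -EposZ; apply: Epos_le => b.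
  have [hM|_] := ltP; last by rewrite mulr_ge0 ?exprn_ge0 ?expR_ge0.
  apply: (@le_trans _ _ (expR 0)); first by rewrite expR0.
  by rewrite -expRM_natl -expRD ler_expR; lra.
apply: (@le_trans _ _ (expR (- (2 * M)) * expR ((expR 2 - 1) * (n%:R * rho)))).
  by rewrite ler_wpM2l ?expR_ge0.
rewrite -expRD ler_expR mulrBl mul1r.
by move: (expR 2) (n%:R * rho) h1 h2 => e mu h1 h2; lra.
Qed.

Lemma expR_le_chord (w x : R) : 0 <= w <= 1 ->
  expR (w * x) <= 1 - w + w * expR x.
Proof.
move=> /andP[w0 w1].
have h1 := expR_klein (w * x) x; have h2 := expR_klein (w * x) 0.
rewrite expR0 in h2.
have {}h1 := ler_wpM2l w0 h1.
have {}h2 : (1 - w) * (expR (w * x) + (0 - w * x) * expR (w * x)) <= (1 - w) * 1.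
  by rewrite ler_wpM2l // subr_ge0.
by move: (expR _) (expR _) h1 h2 => p s h1 h2; lra.
Qed.

(** From exp(-1/6) >= 5/6, since (6/5)^6 < 3. *)
Lemma expR1_le3 : expR 1 <= 3 :> R.
Proof.
have h : expR (6^-1) <= 6 / 5 :> R.
  have := expR_ge1Dx (- 6^-1 : R); rewrite expRN.
  have := expR_gt0 (6^-1 : R); move: (expR _) => y y0 hy.
  have : y * (1 - 6^-1) <= y * y^-1 by rewrite ler_pM2l.
  by rewrite mulfV ?gt_eqF //; lra.
have -> : 1 = 6%:R * 6^-1 :> R by rewrite mulfV.
rewrite expRM_natl; apply: (@le_trans _ _ ((6 / 5) ^+ 6)); last by lra.
by rewrite lerXn2r ?nnegrE ?expR_ge0.
Qed.

(* Conditioning on [b j], the other rows are independent, and the exponential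
   moment of each intersection is controlled by [sum_q_prod]. *)
Lemma Epos_overlap (a : 'I_n -> R) j r : (0 < r)%N ->
  (forall i, 0 <= a i <= 1) -> \sum_i a i <= r%:R ->
  4 * r%:R * (alpha%:R * rho) <= 1 ->
  Epos (fun b => expR (\sum_(i | i != j) a i * #|b i :&: b j|%:R)) <= 3.
Proof.
move=> r0 ha sa small.
set ka := 4 * (alpha%:R * rho).
have ar0 : 0 <= alpha%:R * rho by rewrite mulr_ge0.
have ka0 : 0 <= ka by rewrite mulr_ge0.
have r1 : 1 <= r%:R :> R by rewrite ler1n.
have ar1 : 4 * (alpha%:R * rho) <= 1.
  apply: le_trans small; rewrite -mulrA ler_pM2l //.
  by rewrite ler_peMl.
(* Since [a i] is at most 1, the chord bound reduces the weighted moment to the unweighted one in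
   [h1]. *)
have one (c : {set 'I_d}) i : (#|c| <= alpha)%N ->
    \sum_b q b * expR (a i * #|b :&: c|%:R) <= expR (a i * ka).
  move=> hc; have /andP[a0 a1] := ha i.
  have h1 : \sum_b q b * expR #|b :&: c|%:R <= 1 + ka.
    apply: (@le_trans _ _ (\sum_b q b * \prod_k (1 + (k \in c)%:R * 2 * (k \in b)%:R))).
      apply: ler_sum => b _; rewrite ler_wpM2l //.
      rewrite -[X in expR X]mulr1 expRM_natl -[_ ^+ _]prodr_const big_mkcond /=.
      apply: ler_prod => k _; rewrite inE.
      case: (k \in b); case: (k \in c); rewrite /= ?(mulr1, mul1r, mulr0, mul0r, addr0).
      - by rewrite expR_ge0; have := expR1_le3; lra.
      - by rewrite ler01 lexx.
      - by rewrite ler01 lexx.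
      - by rewrite ler01 lexx.
    apply: le_trans (sum_q_prod _) _ => [k|]; first by rewrite mulr_ge0.
    apply: (@le_trans _ _ (expR (2 * (alpha%:R * rho)))).
      apply: (@le_trans _ _ (\prod_(k in c) expR (2 * rho))).
        rewrite [leRHS]big_mkcond /=; apply: ler_prod => k _.
        case: (k \in c); last by rewrite !mul0r addr0 ler01 lexx.
        by rewrite mul1r addr_ge0 ?mulr_ge0 //= expR_ge1Dx.
      rewrite prodr_const -expRM_natl ler_expR mulrCA ler_wpM2l //.
      by rewrite ler_wpM2r // ler_nat.
    (* As 2 alpha rho <= 1, its exponential is at most 1 + 2 alpha rho (e - 1) <= 1 + [ka]. *)
    have := @expR_le_chord (2 * (alpha%:R * rho)) 1; rewrite mulr1 => h.
    have {}h := h _; apply: le_trans (h _) _.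
      by rewrite mulr_ge0 //=; lra.
    have := expR1_le3; rewrite /ka => e3.
    have : 0 <= 2 * (alpha%:R * rho) * (3 - expR 1) by rewrite !mulr_ge0 // subr_ge0.
    by move: (alpha%:R * rho) (expR 1) => y z; lra.
  apply: (@le_trans _ _ (\sum_b ((1 - a i) * q b + a i * (q b * expR #|b :&: c|%:R)))).
    apply: ler_sum => b _; rewrite [a i * (q b * _)]mulrCA [_ * q b]mulrC -mulrDr.
    by rewrite ler_wpM2l // expR_le_chord ?ha.
  rewrite big_split -!mulr_sumr /=; apply: le_trans (expR_ge1Dx _).
  apply: (@le_trans _ _ ((1 - a i) * 1 + a i * (1 + ka))); last by lra.
  by rewrite lerD // ler_wpM2l ?subr_ge0 ?sum_q_le1.
(* Conditioning on [b j = c] in product form: the factor of row [j] is the indicator of [c], so that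
   [Epos_prod] applies. *)
pose F c i (b : {set 'I_d}) : R :=
  if i == j then (b == c)%:R else expR (a i * #|b :&: c|%:R).
have cond (b : B) : expR (\sum_(i | i != j) a i * #|b i :&: b j|%:R) =
    \sum_c \prod_i F c i (b i).
  rewrite expR_sum (bigD1 (b j)) //= [X in _ + X]big1 ?addr0; last first.
    move=> c hc; rewrite (bigD1 j) //= {1}/F eqxx eq_sym (negPf hc) mul0r.
    by [].
  rewrite [RHS](bigD1 j) //= {1}/F !eqxx mul1r; apply: eq_bigr => i hi.
  by rewrite /F (negPf hi).
have -> : Epos (fun b => expR (\sum_(i | i != j) a i * #|b i :&: b j|%:R)) =
    Epos (fun b => \sum_c \prod_i F c i (b i)).
  by apply: eq_bigr => b _; rewrite cond.
rewrite Epos_sum.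
apply: (@le_trans _ _ (\sum_c q c * 3)); last first.
  by rewrite -mulr_suml ler_piMl // sum_q_le1.
apply: ler_sum => c _; rewrite Epos_prod (bigD1 j) //=.
have -> : \sum_b q b * F c j b = q c.
  rewrite (bigD1 c) //= /F !eqxx mulr1 big1 ?addr0 // => b /negPf ->.
  by rewrite mulr0.
have [->|qc] := eqVneq (q c) 0; first by rewrite !mul0r.
rewrite ler_wpM2l //.
apply: (@le_trans _ _ (\prod_(i | i != j) expR (a i * ka))).
  apply: ler_prod => i hi; rewrite /F (negPf hi) one ?q_card // andbT.
  by apply: sumr_ge0 => b _; rewrite mulr_ge0 ?expR_ge0.
rewrite -expR_sum -mulr_suml; apply: le_trans expR1_le3; rewrite ler_expR.
apply: (@le_trans _ _ (r%:R * ka)); last by rewrite /ka; lra.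
rewrite ler_wpM2r //; apply: le_trans sa; rewrite [leRHS](bigD1 j) //= lerDr.
by case/andP: (ha j).
Qed.

End RowSupports.

(** * Superset probabilities for the two constructions *)

Section RowSupportProb.
Context {R : realType} (d alpha : nat).
Hypothesis alpha_gt0 : (0 < alpha)%N.
Hypothesis alpha_le : (alpha <= d)%N.
Local Notation rho := (alpha%:R / d%:R : R).

Let d_gt0 : (0 < d)%N. Proof. exact: leq_trans alpha_le. Qed.

Lemma row_support_prob_ge0 c (b : {set 'I_d}) :
  0 <= row_support_prob c alpha b :> R.
Proof.
case: c => /=; first by case: ifP => _ //; rewrite invr_ge0.
by apply: prodr_ge0 => k _; case: ifP => _ //; rewrite invr_ge0.
Qed.

(** Removing [U] maps these sets injectively to subsets of its complement with alpha - |U|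
    elements. *)
Lemma card_supersets (U : {set 'I_d}) :
  (#|[set b : {set 'I_d} | (U \subset b) && (#|b| == alpha)]%SET| <=
   'C(d - #|U|, alpha - #|U|))%N.
Proof.
have -> : (d - #|U| = #|~: U|)%N by rewrite [RHS]cardsCs finset.setCK card_ord.
rewrite -cards_draws.
rewrite -(card_in_imset (f := fun b : {set 'I_d} => b :\: U)).
  apply/subset_leq_card/fintype.subsetP => _ /imsetP[b + ->].
  rewrite !inE => /andP[Ub /eqP cb]; rewrite cardsD (finset.setIidPr Ub) cb eqxx andbT.
  by rewrite finset.setDE finset.subsetIr.
move=> b b'; rewrite !inE => /andP[Ub _] /andP[Ub' _] e.
by rewrite -(finset.setID b U) -(finset.setID b' U) e
  (finset.setIidPr Ub) (finset.setIidPr Ub').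
Qed.

(** Telescoping: each step uses (alpha - u) / (d - u) <= alpha / d. *)
Lemma bin_sub_le u : (u <= alpha)%N ->
  ('C(d - u, alpha - u) * d ^ u <= alpha ^ u * 'C(d, alpha))%N.
Proof.
elim: u => [|u IH] ua; first by rewrite !subn0 !expn0 muln1 mul1n.
have {}IH := IH (ltnW ua).
have ud : (u < d)%N by apply: leq_trans alpha_le.
have du : (0 < d - u)%N by rewrite subn_gt0.
rewrite -(leq_pmul2l du).
have e : ((d - u) * 'C(d - u.+1, alpha - u.+1) = (alpha - u) * 'C(d - u, alpha - u))%N.
  have [a ea] : exists a, (alpha - u = a.+1)%N.
    by exists (alpha - u).-1; rewrite prednK // subn_gt0.
  by rewrite !subnS ea /= mul_bin_diag.
rewrite mulnA e expnS [X in (_ <= X)%N]mulnA [(alpha ^ _)%N]expnS.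
apply: (@leq_trans (((alpha - u) * d) * (alpha ^ u * 'C(d, alpha)))%N).
  by rewrite mulnACA leq_mul2l IH orbT.
rewrite !mulnA leq_mul2r leq_mul2r; apply/orP; right; apply/orP; right.
rewrite mulnBl mulnBl [(alpha * d)%N]mulnC leq_sub // ?leq_mul2l ?alpha_le ?orbT //.
Qed.

Lemma graph_superset (U : {set 'I_d}) :
  \sum_(b : {set 'I_d} | U \subset b) row_support_prob Graph alpha b <=
  rho ^+ #|U|.
Proof.
rewrite /= -big_mkcondr /= sumr_const.
have [Ua|Ua] := leqP #|U| alpha; last first.
  rewrite (_ : #|_| = 0%N) ?mulr0n ?exprn_ge0 ?divr_ge0 //.
  apply: eq_card0 => b; rewrite !inE; apply/negP => /andP[Ub /eqP cb].
  by have := subset_leq_card Ub; rewrite cb leqNgt Ua.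
have C0 : 0 < ('C(d, alpha))%:R :> R by rewrite ltr0n bin_gt0.
rewrite -[leLHS]mulr_natl ler_pdivrMr // expr_div_n mulrAC ler_pdivlMr; last first.
  by rewrite exprn_gt0 // ltr0n.
rewrite -!natrX -!natrM ler_nat; apply: leq_trans (bin_sub_le Ua).
rewrite leq_mul2r; apply/orP; right; apply: leq_trans (card_supersets U).
by rewrite leq_eqVlt; apply/orP; left; apply/eqP; apply: eq_card => b; rewrite !inE.
Qed.

Section BlockCase.
Hypothesis alpha_dvd : (alpha %| d)%N.
Local Notation s := (d %/ alpha)%N.

Let s_gt0 : (0 < s)%N. Proof. by rewrite divn_gt0. Qed.
Let dE : d = (s * alpha)%N. Proof. by rewrite divnK. Qed.

Let idx_lt (j : 'I_d) : (j %/ s < alpha)%N.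
Proof. by rewrite ltn_divLR // mulnC -dE. Qed.
Let idx (j : 'I_d) : 'I_alpha := Ordinal (idx_lt j).

Let in_chunk (j : 'I_d) (k : 'I_alpha) : (j \in chunk d k) = (idx j == k).
Proof. by rewrite inE. Qed.

Let card_chunk (k : 'I_alpha) : (#|chunk d k| <= s)%N.
Proof.
have lt (j : 'I_d) : (j %% s < s)%N by rewrite ltn_mod.
rewrite -[X in (_ <= X)%N]card_ord.
apply: (leq_card_in (fun j : 'I_d => Ordinal (lt j))) => j j'.
rewrite !inE => /eqP ej /eqP ej' /(congr1 val) /= e.
by apply/val_inj; rewrite /= (divn_eq j s) (divn_eq j' s) ej ej' e.
Qed.

Let good (b : {set 'I_d}) := [forall k, #|b :&: chunk d (k : 'I_alpha)| == 1%N].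

Let block_prob (b : {set 'I_d}) :
  row_support_prob Block alpha b = (good b)%:R * (s%:R^-1) ^+ alpha :> R.
Proof.
rewrite /=; case: (boolP (good b)) => [/forallP h|/forallPn[k hk]].
  rewrite mul1r (eq_bigr (fun=> s%:R^-1)) => [|k _]; last by rewrite h.
  by rewrite prodr_const card_ord.
by rewrite mul0r (bigD1 k) //= (negPf hk) mul0r.
Qed.

(** Encodes a good set as the function choosing its element in each chunk, so that counting factors
    over chunks. The default value arises only when a chunk is missed. *)
Let pick (b : {set 'I_d}) : {ffun 'I_alpha -> 'I_d} :=
  [ffun k => odflt (Ordinal d_gt0) [pick j in b :&: chunk d k]].

Let pickP b k j : good b -> (j \in b) && (idx j == k) = (j == pick b k).
Proof.
move=> /forallP/(_ k)/cards1P[y hy]; rewrite ffunE hy.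
case: pickP => [z|/(_ y)]; last by rewrite inE eqxx.
rewrite inE => /eqP -> /=.
by have := congr1 (fun A : {set 'I_d} => j \in A) hy; rewrite /= finset.in_setI in_chunk finset.in_set1.
Qed.

Lemma block_superset (U : {set 'I_d}) :
  \sum_(b : {set 'I_d} | U \subset b) row_support_prob Block alpha b <=
  rho ^+ #|U|.
Proof.
have rhoE : rho = s%:R^-1.
  rewrite [in d%:R]dE natrM invfM mulrCA mulfV ?mulr1 //.
  by rewrite pnatr_eq0 -lt0n.
have s0 : 0 < s%:R :> R by rewrite ltr0n.
under eq_bigr do rewrite block_prob.
rewrite -mulr_suml -natr_sum rhoE.
(* The choices left in chunk [k]: all of them if [U] misses it, the prescribed one if [U] meets it
   once, none if [U] meets it twice. *)
pose F (k : 'I_alpha) : {set 'I_d} :=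
  [set j in chunk d k | [forall u in U, (idx u == k) ==> (u == j)]]%SET.
have cnt : (\sum_(b : {set 'I_d} | U \subset b) good b <= \prod_k #|F k|)%N.
  have -> : (\sum_(b : {set 'I_d} | U \subset b) good b)%N =
      #|[set b : {set 'I_d} | (U \subset b) && good b]%SET|.
    rewrite -sum1_card [RHS]big_mkcond [LHS]big_mkcond; apply: eq_bigr => b _.
    by rewrite inE; case: (U \subset b); case: (good b).
  rewrite -(card_in_imset (f := pick)); last first.
    move=> b b'; rewrite !inE => /andP[_ gb] /andP[_ gb'] e; apply/setP => j.
    by have := pickP (idx j) j gb; have := pickP (idx j) j gb'; rewrite e eqxx !andbT => -> ->.
  have -> : (\prod_k #|F k| = #|family F|)%N.
    by rewrite card_family foldrE big_image.
  apply/subset_leq_card/fintype.subsetP => _ /imsetP[b + ->].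
  rewrite inE => /andP[Ub gb]; apply/familyP => k.
  have /andP[hb hk] : (pick b k \in b) && (idx (pick b k) == k).
    by rewrite pickP // eqxx.
  rewrite inE in_chunk hk /=; apply/forallP => u; apply/implyP => uU.
  apply/implyP => hu; rewrite -pickP // hu andbT.
  exact: (fintype.subsetP Ub).
have hF : (\prod_k #|F k| * s ^ #|U| <= s ^ alpha)%N.
  pose T := (idx @: U)%SET.
  have [/imset_injP inj|/imset_injP ninj] := boolP (#|T| == #|U|); last first.
    suff [k hk] : exists k, #|F k| = 0%N by rewrite (bigD1 k) //= hk !mul0n.
    have [u uU [u' [u'U e ne]]] : exists2 u, u \in U &
        exists u', [/\ u' \in U, idx u = idx u' & u != u'].
      apply: contrapT => H; apply: ninj => u u' uU u'U e; apply/eqP.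
      apply: contrapT => /negP ne; apply: H.
      by exists u => //; exists u'.
    exists (idx u); apply: eq_card0 => j; rewrite inE; apply/negP => /andP[_ /forallP h].
    have /implyP/(_ uU) := h u; have /implyP/(_ u'U) := h u'.
    by rewrite -e eqxx => /eqP e1 /eqP e2; rewrite e1 e2 eqxx in ne.
  have cT : #|T| = #|U| by apply: card_in_imset.
  apply: (@leq_trans ((\prod_(k | k \notin T) s) * s ^ #|U|)%N).
    rewrite leq_mul2r; apply/orP; right.
    rewrite (bigID (mem T)) /= -[X in (_ <= X)%N]mul1n leq_mul //.
      apply: (@leq_trans (\prod_(k in T) 1)%N); last by rewrite big1_eq.
      apply: leq_prod => k /imsetP[u uU ->]; rewrite -(cards1 u).
      apply/subset_leq_card/fintype.subsetP => j.
      rewrite !inE => /andP[_ /forallP/(_ u)].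
      by rewrite uU eqxx /= eq_sym.
    apply: leq_prod => k _; apply: leq_trans (card_chunk k).
    by apply/subset_leq_card/fintype.subsetP => j; rewrite inE => /andP[].
  rewrite prod_nat_const -expnD leq_pexp2l // -cT -[X in (_ <= X)%N]card_ord.
  rewrite -(cardC (mem T)) addnC leq_add2l.
  by rewrite leq_eqVlt; apply/orP; left; apply/eqP; apply: eq_card => b; rewrite !inE.
rewrite !exprVn ler_pdivrMr ?exprn_gt0 // mulrC ler_pdivlMr ?exprn_gt0 //.
rewrite -!natrX -natrM ler_nat; apply: leq_trans hF.
by rewrite leq_mul2r cnt orbT.
Qed.

Lemma block_card (b : {set 'I_d}) :
  row_support_prob Block alpha b != 0 :> R -> #|b| = alpha.
Proof.
rewrite block_prob; case: (boolP (good b)) => [gb _|]; last by rewrite mul0r eqxx.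
have -> : b = [set pick b k | k : 'I_alpha]%SET.
  apply/setP => j; apply/idP/imsetP => [jb|[k _ ->]].
    exists (idx j) => //; apply/eqP; by rewrite -pickP // jb eqxx.
  have /andP[//] : (pick b k \in b) && (idx (pick b k) == k).
  by rewrite pickP // eqxx.
rewrite card_imset ?card_ord // => k k' e.
have hk l : idx (pick b l) = l.
  by apply/eqP; have /andP[] : (pick b l \in b) && (idx (pick b l) == l)
    by rewrite pickP // eqxx.
by rewrite -(hk k) e hk.
Qed.

End BlockCase.

Lemma row_support_prob_superset c (U : {set 'I_d}) :
  (c = Block -> alpha %| d)%N ->
  \sum_(b : {set 'I_d} | U \subset b) row_support_prob c alpha b <= rho ^+ #|U|.
Proof.
case: c => [_|/(_ erefl) dvd]; first exact: graph_superset.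
exact: block_superset.
Qed.

Lemma row_support_prob_card c (b : {set 'I_d}) :
  (c = Block -> alpha %| d)%N ->
  row_support_prob c alpha b != 0 :> R -> #|b| = alpha.
Proof.
case: c => [_|/(_ erefl) dvd]; last exact: block_card.
by rewrite /=; case: (eqVneq #|b| alpha) => [->//|]; rewrite eqxx.
Qed.

End RowSupportProb.

(** * The law of the sketch *)

Section FiniteModel.
Context {R : realType} (n d alpha : nat) (c : sjlt_construction).
Local Notation I := ('I_n * 'I_d)%type.
Local Notation S := {ffun I -> bool}.
Local Notation B := {ffun 'I_n -> {set 'I_d}}.
Hypothesis alpha_gt0 : (0 < alpha)%N.

(** Signs are drawn at all positions, so the sign space is the same for all supports and [Esg]
    averages over it directly. *)
Definition sjlt_mx (b : B) (s : S) : 'M[R]_(n, d) :=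
  \matrix_(i, j) if j \in b i then sg (s (i, j)) * (Num.sqrt alpha%:R)^-1 else 0.

Definition sjlt_prob (G : set 'M[R]_(n, d)) : R :=
  Epos (row_support_prob c alpha) (fun b => Esg (fun s => `[< G (sjlt_mx b s) >]%:R)).

Let beta_neq0 : (Num.sqrt alpha%:R)^-1 != 0 :> R.
Proof. by rewrite invr_eq0 gt_eqF // sqrtr_gt0 ltr0n. Qed.

Let sg_neq0 x : sg x != 0 :> R.
Proof. by rewrite /sg signr_eq0. Qed.

Let sg_inj : injective (@sg R).
Proof. by move=> [] []; rewrite /sg ?expr0 ?expr1 // => h; exfalso; lra. Qed.

Lemma row_support_sjlt_mx b s i : row_support (sjlt_mx b s) i = b i.
Proof.
apply/setP => j; rewrite inE mxE; case: (j \in b i); last by rewrite eqxx.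
by rewrite mulf_neq0.
Qed.

Lemma sjlt_mx_eq b b' s s' : (sjlt_mx b' s' == sjlt_mx b s) =
  (b' == b) && [forall p, (p.2 \in b p.1) ==> (s' p == s p)].
Proof.
apply/eqP/andP => [e|[/eqP -> /forallP h]].
  have eb : b' = b.
    by apply/ffunP => i; rewrite -(row_support_sjlt_mx b' s') e row_support_sjlt_mx.
  split; first by rewrite eb.
  apply/forallP => -[i j]; apply/implyP => /= hj; move/matrixP/(_ i j): e.
  rewrite !mxE eb hj => /(mulIf beta_neq0).
  by move=> /sg_inj ->.
apply/matrixP => i j; rewrite !mxE; case: ifP => // hj.
by have /implyP/(_ hj)/eqP -> := h (i, j).
Qed.

Lemma Esg_prod (g : I -> bool -> R) :
  Esg (fun s => \prod_p g p (s p)) = \prod_p ((g p true + g p false) / 2).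
Proof.
rewrite /Esg -bigA_distr_bigA /= big_split /= prodr_const.
rewrite card_ffun card_bool natrX exprVn mulrC; congr (_ / _).
by apply: eq_bigr => p _; rewrite big_bool.
Qed.

Lemma sjlt_prob1 b s : sjlt_prob [set sjlt_mx b s] =
  (\prod_i row_support_prob c alpha (b i)) * \prod_i \prod_(j in b i) 2^-1.
Proof.
rewrite /sjlt_prob /Epos (bigD1 b) //= [X in _ + X]big1 ?addr0; last first.
  move=> b' hb; rewrite [X in _ * X](_ : _ = 0) ?mulr0 //.
  rewrite -[RHS](Esg_cst I 0); apply: eq_Esg => s'.
  by case: asboolP => //= /eqP; rewrite sjlt_mx_eq (negPf hb).
congr (_ * _).
pose g (p : I) (x : bool) : R := if p.2 \in b p.1 then (x == s p)%:R else 1.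
rewrite (eq_Esg (g := fun s' => \prod_p g p (s' p))); last first.
  move=> s'; case: asboolP => [/eqP|/eqP].
    rewrite sjlt_mx_eq eqxx /= => /forallP h; rewrite big1 // => p _.
    by rewrite /g; case: ifP => // hp; have := h p; rewrite hp /= => ->.
  rewrite sjlt_mx_eq eqxx /= => /forallPn[p]; rewrite negb_imply => /andP[hp ne].
  by rewrite (bigD1 p) //= /g hp (negPf ne) mul0r.
rewrite Esg_prod; under [RHS]eq_bigr do rewrite big_mkcond.
rewrite (pair_bigA _ (fun i j => if j \in b i then 2^-1 else 1)) /=.
apply: eq_bigr => p _.
rewrite /g; case: ifP => _.
  by case: (s p); rewrite ?addr0 ?add0r mul1r.
by rewrite divff.
Qed.

(** * Transfer from the probability space to the finite model *)

Section Law.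
Context disp (T : measurableType disp) (P : probability T R)
  (X : 'I_n -> 'I_d -> {RV P >-> R}).
Hypothesis hX : is_SJLT c alpha X.

Let rm (w : T) := random_matrix X w.

Lemma measurable_random_matrix M : measurable [set w | rm w = M].
Proof.
have -> : [set w | rm w = M] =
    \bigcap_(p in [set: I]) (X p.1 p.2 @^-1` [set M p.1 p.2]).
  apply/seteqP; split => [w /= <- p _ /=|w h]; first by rewrite mxE.
  by apply/matrixP => i j; rewrite mxE; exact: (h (i, j)).
apply: fin_bigcap_measurable => [|p _]; first exact: finite_finset.
by apply: measurable_funPTI; apply: measurable_set1.
Qed.

Lemma random_matrix_sjlt_mx w : exists b s, rm w = sjlt_mx b s.
Proof.
exists [ffun i => row_support (rm w) i], [ffun p => X p.1 p.2 w < 0].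
apply/matrixP => i j; rewrite !mxE !ffunE inE mxE /=.
case: eqP => [->//|/eqP h] /=; have b0 : 0 < (Num.sqrt alpha%:R)^-1 :> R.
  by rewrite invr_gt0 sqrtr_gt0 ltr0n.
have [-> | ->] := sjlt_values hX h.
  by rewrite ltNge ltW //= /sg expr0 mul1r.
by rewrite oppr_lt0 b0 /sg expr1 mulN1r.
Qed.

Lemma law_sjlt_mx b s :
  P [set w | rm w = sjlt_mx b s] = (sjlt_prob [set sjlt_mx b s])%:E.
Proof.
rewrite sjlt_prob1 EFinM -(sjlt_positions hX b).
rewrite -(sjlt_signs hX b (fun i j => s (i, j))); congr (P _).
apply/seteqP; split => w /= => [e|[hb hs]].
  split=> [i|i j hj]; first by rewrite -/(rm w) e row_support_sjlt_mx.
  by move/matrixP/(_ i j): e; rewrite !mxE hj.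
apply/matrixP => i j; rewrite !mxE; case: ifP => [hj|/negbT hj]; first exact: hs.
by apply/eqP; move: hj; rewrite -hb inE mxE negbK.
Qed.

(** The random matrix takes finitely many values, so any event is a finite disjoint union of atoms.
    This gives measurability as well, whatever [G] is. *)
Lemma law_sjlt (G : set 'M[R]_(n, d)) :
  measurable [set w | G (rm w)] /\ P [set w | G (rm w)] = (sjlt_prob G)%:E.
Proof.
pose l := undup [seq sjlt_mx p.1 p.2 | p <- enum {: B * S}].
have inl b s : sjlt_mx b s \in l.
  by rewrite mem_undup; apply/mapP; exists (b, s); rewrite ?mem_enum.
have sub M : M \in l -> P [set w | rm w = M] = (sjlt_prob [set M])%:E.
  by rewrite mem_undup => /mapP[[b s] _ ->]; apply: law_sjlt_mx.
suff h (l' : seq 'M[R]_(n, d)) : uniq l' -> {subset l' <= l} ->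
    measurable [set w | G (rm w) /\ rm w \in l'] /\
    P [set w | G (rm w) /\ rm w \in l'] =
      (sjlt_prob [set M | G M /\ M \in l'])%:E.
  have := h l (undup_uniq _) (fun _ => id).
  have -> : [set w | G (rm w) /\ rm w \in l] = [set w | G (rm w)].
    apply/seteqP; split => w /=; first by case.
    by move=> g; split=> //; have [b [s e]] := random_matrix_sjlt_mx w; rewrite e inl.
  have -> // : sjlt_prob [set M | G M /\ M \in l] = sjlt_prob G.
  apply: eq_bigr => b _; congr (_ * _); apply: eq_Esg => s; congr (nat_of_bool _)%:R.
  by apply/asboolP/asboolP => /=; [case|rewrite inl].
have p0 (F : set 'M[R]_(n, d)) : (forall M, ~ F M) -> sjlt_prob F = 0.
  move=> hF; rewrite /sjlt_prob /Epos big1 // => b _.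
  rewrite (eq_Esg (g := fun=> 0)) ?Esg_cst ?mulr0 // => s.
  by case: asboolP => // /hF.
elim: l' => [_ _|M l' IH /= /andP[Ml' ul'] sl].
  have -> : [set w | G (rm w) /\ rm w \in [::]] = set0.
    by apply/seteqP; split => w //= -[].
  by rewrite measure0 p0 // => M [].
have [mIH eIH] := IH ul' (fun M' h => sl M' (mem_behead (s := M :: l') h)).
have hM := sub M (sl M (mem_head _ _)).
have [gM|ngM] := pselect (G M); last first.
  have -> : [set w | G (rm w) /\ rm w \in M :: l'] = [set w | G (rm w) /\ rm w \in l'].
    apply/seteqP; split => w /= -[g]; rewrite inE; last by move=> ->; rewrite orbT.
    by case/orP => [/eqP e|//]; rewrite e in g.
  split => //; rewrite eIH; congr (_%:E); congr (sjlt_prob _).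
  apply/seteqP; split => M' /= -[g]; rewrite ?inE; first by move=> ->; rewrite orbT.
  by case/orP => [/eqP e|//]; rewrite e in g.
have -> : [set w | G (rm w) /\ rm w \in M :: l'] =
    [set w | rm w = M] `|` [set w | G (rm w) /\ rm w \in l'].
  apply/seteqP; split => w /=.
    by move=> [g]; rewrite inE => /orP[/eqP->|]; [left|right].
  by move=> [->|[g h]]; rewrite inE ?eqxx ?h ?orbT.
split; first by apply: measurableU => //; apply: measurable_random_matrix.
rewrite measureU //; [|exact: measurable_random_matrix|].
  transitivity ((sjlt_prob [set M])%:E + (sjlt_prob [set M | G M /\ M \in l'])%:E)%E.
    by congr (_ + _)%E; [exact: hM|exact: eIH].
  rewrite -EFinD; congr (_%:E).
  rewrite /sjlt_prob /Epos -big_split; apply: eq_bigr => b _ /=.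
  rewrite -mulrDr -EsgD; congr (_ * _); apply: eq_Esg => s.
  have [->|ne] := eqVneq (sjlt_mx b s) M.
    have -> : `[< [set M0 | G M0 /\ M0 \in M :: l'] M >] = true.
      by apply/asboolP; split => //; rewrite inE eqxx.
    have -> : `[< [set M0 | G M0 /\ M0 \in l'] M >] = false.
      by apply/asboolPn => -[_]; rewrite (negPf Ml').
    have -> : `[< [set M] M >] = true by apply/asboolP.
    by rewrite addr0.
  have -> : `[< [set M] (sjlt_mx b s) >] = false.
    by apply/asboolPn => /= e; rewrite e eqxx in ne.
  rewrite add0r.
  congr (nat_of_bool _)%:R; apply/asboolP/asboolP => /= -[g h]; split => //.
    by rewrite inE h orbT.
  by move: h; rewrite inE (negPf ne).
apply/seteqP; split => w //= -[e [_]]; rewrite e => h.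
by rewrite h in Ml'.
Qed.

(** Read off from [P] being a probability, for both constructions at once. *)
Lemma sjlt_prob_total : sjlt_prob setT = 1.
Proof.
have [_] := law_sjlt setT.
have -> : [set w | [set: 'M[R]_(n, d)] (rm w)] = [set: T] by apply/seteqP.
by rewrite probability_setT => -[].
Qed.

End Law.
End FiniteModel.

(** * Deterministic error bound *)

Section RangeFinder.
Context {R : realType}.
Local Notation C := R[i].

Lemma vnorm2E n (x : 'cV[C]_n) : vnorm2 x = Num.sqrt (nsq x^T).
Proof.
rewrite /vnorm2 nsqE; congr Num.sqrt; apply: eq_bigr => i _.
rewrite mxE; case: (x i 0) => a b /=.
by rewrite sqr_sqrtr // addr_ge0 ?sqr_ge0.
Qed.

Lemma nsq_conj n (x : 'rV[C]_n) : nsq (map_mx Num.conj x) = nsq x.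
Proof. by rewrite !nsqE; apply: eq_bigr => i _; rewrite mxE sqn_conj. Qed.

Lemma nsq_mul_adj m n (A : 'M[C]_(m, n)) (y : 'rV[C]_n) :
  nsq (y *m A^t*) = qf (A^t* *m A) y.
Proof. by rewrite /nsq /qf /ip trmx_mul map_mxM /= trmxCK !mulmxA. Qed.

Lemma herm_gram m n (A : 'M[C]_(m, n)) : herm (A^t* *m A).
Proof. by rewrite /herm trmx_mul map_mxM /= trmxCK. Qed.

Lemma ev_gram_ge0 m n (A : 'M[C]_(m, n)) i : 0 <= ev (A^t* *m A) i.
Proof. by rewrite -(qf_evec _ (herm_gram A)) -nsq_mul_adj nsq_ge0. Qed.

(** Sorting the indices by their singular values, instead of sorting the values, keeps track of the
    eigenvectors. *)
Lemma top_indices m n (A : 'M[C]_(m, n)) r : (r < n)%N ->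
  exists2 iota : 'I_r -> 'I_n, injective iota &
    0 <= sigma A r.+1 /\
    forall i, i \notin codom iota -> ev (A^t* *m A) i <= sigma A r.+1 ^+ 2.
Proof.
move=> rn; pose f i := Num.sqrt (ev (A^t* *m A) i).
pose leT := relpre f (>=%R : rel R); pose s := sort leT (enum 'I_n).
have ss : size s = n by rewrite size_sort size_enum_ord.
have us : uniq s by rewrite sort_uniq enum_uniq.
have i0 : 'I_n := Ordinal rn.
have sE : singular_values A = [seq f i | i <- s] by rewrite /singular_values sort_map.
have tr : transitive leT by move=> y x z /= h1 h2; apply: le_trans h2 h1.
have rf : reflexive leT by move=> x /=.
have srt : sorted leT s by apply: sort_sorted => x y /=; exact: le_total.
(* [sigma] counts from 1 and [nth] from 0: sigma_(r+1) sits at position [r], and the positions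
   before it give [iota]. *)
have sigE : sigma A r.+1 = f (nth i0 s r).
  by rewrite /sigma sE (nth_map i0) // ss.
have lt (l : 'I_r) : (l < size s)%N by rewrite ss (ltn_trans (ltn_ord l)).
exists (fun l : 'I_r => nth i0 s l).
  by move=> l l' /eqP; rewrite nth_uniq // => /eqP/val_inj.
split; first by rewrite sigE sqrtr_ge0.
move=> i hi; have is_ : i \in s by rewrite mem_sort mem_enum.
have hidx : (r <= index i s)%N.
  rewrite leqNgt; apply: contra hi => h.
  by apply/codomP; exists (Ordinal h); rewrite /= nth_index.
have := sorted_leq_nth tr rf i0 srt r (index i s).
rewrite !inE index_mem is_ ss rn => /(_ isT isT hidx).
rewrite nth_index // /leT /= -sigE /f => h.
by rewrite -(sqr_sqrtr (ev_gram_ge0 A i)) lerXn2r ?nnegrE ?sqrtr_ge0 // sigE sqrtr_ge0.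
Qed.

(** I - P kills [Y *m z], and an orthogonal projector does not increase norms. *)
Lemma nsq_col_proj_compl m d (Y : 'M[C]_(m, d)) (w : 'cV[C]_m) (z : 'cV[C]_d) :
  nsq ((1%:M - col_proj Y) *m w)^T <= nsq (w - Y *m z)^T.
Proof.
set Q := proj_ortho Y^T.
have trE (u : 'cV[C]_m) : ((1%:M - col_proj Y) *m u)^T = u^T - u^T *m Q.
  by rewrite trmx_mul linearB /= trmx1 /col_proj trmxK mulmxBr mulmx1.
have -> : (1%:M - col_proj Y) *m w = (1%:M - col_proj Y) *m (w - Y *m z).
  apply: trmx_inj; rewrite !trE linearB /= trmx_mul mulmxBl.
  rewrite [(z^T *m Y^T) *m Q]proj_ortho_id ?submxMl //.
  by rewrite opprB addrA subrK.
move: (w - Y *m z) => u; rewrite trE.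
have /eqP orth : (u^T - u^T *m Q) *m (Y^T)^t* == 0.
  by rewrite -orthomx1E proj_ortho_compl_sub.
have /submxP [D hD] : (u^T *m Q <= Y^T)%MS by apply: proj_ortho_sub.
have ip0 : ip (u^T - u^T *m Q) (u^T *m Q) = 0.
  by rewrite /ip {2}hD trmx_mul map_mxM mulmxA orth mul0mx mxE.
have := nsqD (u^T - u^T *m Q) (u^T *m Q).
by rewrite subrK ip0 mulr0 addr0 => ->; rewrite lerDl nsq_ge0.
Qed.

Lemma sqn_sub_le (s : R) (a b : C) : 0 < s ->
  sqn (a - b) <= (1 + s) * sqn a + (1 + s^-1) * sqn b.
Proof.
move=> s0; rewrite -subr_ge0; case: a b => [a a'] [b b'] /=.
rewrite /sqn /=.
have -> : (1 + s) * (a ^+ 2 + a' ^+ 2) + (1 + s^-1) * (b ^+ 2 + b' ^+ 2) -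
    ((a - b) ^+ 2 + (a' - b') ^+ 2) =
    s^-1 * ((s * a + b) ^+ 2 + (s * a' + b') ^+ 2) by field; rewrite gt_eqF.
by rewrite mulr_ge0 ?invr_ge0 ?(ltW s0) // addr_ge0 ?sqr_ge0.
Qed.

Section Frame.
Context m n r (A : 'M[C]_(m, n)) (iota : 'I_r -> 'I_n).
Hypothesis iota_inj : injective iota.

Definition top_mx : 'M[C]_(r, n) :=
  \matrix_(l, i) evec (A^t* *m A) (iota l) 0 i.
Definition top_vec (i : 'I_n) : 'rV[C]_r := row i (top_mx^t*).

Lemma top_mx_unitary : top_mx *m top_mx^t* = 1%:M.
Proof.
apply/matrixP => l l'; rewrite !mxE.
rewrite (eq_bigr (fun i => evec (A^t* *m A) (iota l) 0 i *
  Num.conj (evec (A^t* *m A) (iota l') 0 i))); last by move=> i _; rewrite !mxE.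
by rewrite -ipE ip_evec (inj_eq iota_inj).
Qed.

Lemma ip_top_vec x i : ip x (top_vec i) = (x *m top_mx) 0 i.
Proof.
rewrite ipE mxE; apply: eq_bigr => l _.
by rewrite !mxE conjCK.
Qed.

Lemma top_frame x : \sum_i sqn (ip x (top_vec i)) = nsq x.
Proof.
under eq_bigr do rewrite ip_top_vec.
rewrite -nsqE /nsq /ip trmx_mul map_mxM /= !mulmxA -[x *m _ *m _]mulmxA.
by rewrite top_mx_unitary mulmx1.
Qed.

Lemma mul_top_adj y l : (y *m top_mx^t*) 0 l = ip y (evec (A^t* *m A) (iota l)).
Proof. by rewrite ipE mxE; apply: eq_bigr => i _; rewrite !mxE. Qed.

Context d (S : 'M[R]_(n, d)) (sig eps M : R).
Local Notation Sc := (map_mx (real_complex R) S).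
Hypothesis sig_ge0 : 0 <= sig.
Hypothesis sig_le : forall i, i \notin codom iota -> ev (A^t* *m A) i <= sig ^+ 2.
Hypothesis eps_lt1 : eps < 1.
Hypothesis M_gt0 : 0 < M.
Hypothesis embed : forall x : 'rV[C]_r, nsq x = 1 ->
  1 - eps <= \sum_k sqn (\sum_i (S i k)%:C%C * ip x (top_vec i)).
Hypothesis bounded : forall z : 'rV[C]_d,
  \sum_i sqn (\sum_k (S i k)%:C%C * z 0 k) <= M * nsq z.

Let ES := top_mx *m Sc.

Let embed_mul x : (1 - eps) * nsq x <= nsq (x *m ES).
Proof.
have [x0|xn0] := eqVneq (nsq x) 0.
  by rewrite (nsq_eq0 x0) mul0mx !nsq0 mulr0.
have x1 : 0 < nsq x by rewrite lt_def xn0 nsq_ge0.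
pose a : R := (Num.sqrt (nsq x))^-1.
have a2 : a ^+ 2 = (nsq x)^-1 by rewrite exprVn sqr_sqrtr ?ltW.
have ax : nsq (a%:C%C *: x) = 1 by rewrite nsqZ sqn_real a2 mulVf.
have := embed ax.
rewrite (eq_bigr (fun k => sqn ((a%:C%C *: x *m ES) 0 k))); last first.
  move=> k _; congr sqn; rewrite /ES mulmxA mxE; apply: eq_bigr => i _.
  by rewrite ip_top_vec [Sc _ _]mxE mulrC.
by rewrite -nsqE -scalemxAl nsqZ sqn_real a2 ler_pdivlMl // mulrC.
Qed.

Let bounded_mul z : nsq (z *m Sc^t*) <= M * nsq z.
Proof.
apply: le_trans (bounded z); rewrite nsqE le_eqVlt; apply/orP; left; apply/eqP.
apply: eq_bigr => i _; congr sqn; rewrite mxE; apply: eq_bigr => k _.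
by rewrite !mxE conj_real mulrC.
Qed.

(* The minimum-norm [z] matching the component [b] along the top singular vectors. *)
Let correction (b : 'rV[C]_r) : exists2 z : 'rV[C]_d,
  z *m Sc^t* *m top_mx^t* = b & nsq z <= (1 - eps)^-1 * nsq b.
Proof.
have e1 : 0 < 1 - eps by rewrite subr_gt0.
pose G := ES *m ES^t*.
have Gu : G \in unitmx.
  rewrite -row_free_unit; apply: inj_row_free => x xG.
  apply: nsq_eq0; apply/eqP; rewrite eq_le nsq_ge0 andbT.
  rewrite -(ler_pM2l e1) mulr0; apply: le_trans (embed_mul x) _.
  by rewrite /nsq /ip trmx_mul map_mxM /= -mulmxA (mulmxA ES) mulmxA xG mul0mx mxE.
pose g := b *m invmx G.
have gG : g *m G = b by rewrite /g mulmxKV.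
have zz : nsq (g *m ES) = complex.Re (ip b g).
  by rewrite /nsq /ip trmx_mul map_mxM /= -mulmxA (mulmxA ES) mulmxA gG.
exists (g *m ES).
  rewrite -[RHS]gG /G {2}/ES trmx_mul map_mxM /= !mulmxA.
  by [].
(* With z = [g *m ES]: |z|^4 <= |b|^2 |g|^2 by Cauchy-Schwarz and (1 - eps) |g|^2 <= |z|^2; a factor
   |z|^2 cancels. *)
have h := embed_mul g; have cs := le_trans (Re_sqr_le_sqn _) (cauchy_schwarz b g).
rewrite -zz in cs; have z0 := nsq_ge0 (g *m ES); have b0 := nsq_ge0 b.
have [->|zn0] := eqVneq (nsq (g *m ES)) 0; first by rewrite mulr_ge0 ?invr_ge0 ?(ltW e1).
have z1 : 0 < nsq (g *m ES) by rewrite lt_def zn0.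
rewrite ler_pdivlMl // -(ler_pM2r z1).
have {}h := ler_wpM2l b0 h; have {}cs := ler_wpM2l (ltW e1) cs.
by move: (nsq (g *m ES)) (nsq g) (nsq b) h cs => p s t h cs; lra.
Qed.

Lemma range_finder_error : spectral_norm ((1%:M - col_proj (A *m Sc)) *m A) <=
  sig * Num.sqrt (1 + (1 - eps)^-1 * M).
Proof.
have e1 : 0 < 1 - eps by rewrite subr_gt0.
set s : R := (1 - eps)^-1 * M; have s0 : 0 < s by rewrite mulr_gt0 ?invr_gt0.
apply: ge_sup.
  exists (vnorm2 ((1%:M - col_proj (A *m Sc)) *m A *m (0 : 'cV[C]_n))) => /=.
  by exists 0 => //=; rewrite vnorm2E trmx0 nsq0 sqrtr0.
move=> _ [u /= u1 <-]; rewrite [leLHS]vnorm2E.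
have {}u1 : nsq u^T <= 1.
  rewrite -(sqr_sqrtr (nsq_ge0 _)) -vnorm2E expr_le1 //.
  by rewrite vnorm2E sqrtr_ge0.
(* The adjoint turns columns into rows, the convention of [ip] and [evec]. *)
pose y : 'rV[C]_n := u^t*.
have y1 : nsq y <= 1 by rewrite nsq_conj.
have [z zb zs] := correction (y *m top_mx^t*).
pose t := z *m Sc^t*; pose y' := y - t.
have key : nsq ((1%:M - col_proj (A *m Sc)) *m (A *m u))^T <= nsq (y' *m A^t*).
  apply: le_trans (nsq_col_proj_compl (A *m Sc) (A *m u) (z^t*)) _.
  rewrite -[leLHS]nsq_conj /y' /t /y le_eqVlt; apply/orP; left; apply/eqP.
  congr nsq; rewrite linearB /= map_mxB mulmxBl !trmx_mul !map_mxM /=.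
  by rewrite trmxCK mulmxA.
rewrite -mulmxA; apply: (@le_trans _ _ (Num.sqrt (sig ^+ 2 * (1 + s)))); last first.
  by rewrite sqrtrM ?sqr_ge0 // sqrtr_sqr ger0_norm.
rewrite ler_wsqrtr //; apply: le_trans key _.
rewrite nsq_mul_adj (qf_spectral _ (herm_gram A)).
(* The corrected vector has no component along the top eigenvectors, so the Gram matrix acts on it
   with factor at most sig^2. *)
have zero l : ip y' (evec (A^t* *m A) (iota l)) = 0.
  by rewrite -mul_top_adj /y' mulmxBl /t zb subrr mxE.
pose e i := sqn (ip y (evec (A^t* *m A) i)).
have ny : nsq y = \sum_i e i by rewrite (nsq_parseval (A^t* *m A)).
have nb : nsq (y *m top_mx^t*) = \sum_(i in codom iota) e i.
  rewrite nsqE (eq_bigr (fun l => e (iota l))); last by move=> l _; rewrite mul_top_adj.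
  rewrite -(big_imset (h := iota) (fun i => e i)) /=; last by move=> l l' _ _; apply: iota_inj.
  by apply: eq_bigl => i; apply/imsetP/codomP => [[l _ ->]|[l ->]]; exists l.
have nt : nsq t = \sum_i sqn (ip t (evec (A^t* *m A) i)) by rewrite -nsq_parseval.
have tle : nsq t <= s * \sum_(i in codom iota) e i.
  apply: le_trans (bounded_mul z) _; rewrite -nb /s [_^-1 * M]mulrC -mulrA.
  by rewrite ler_wpM2l ?(ltW M_gt0).
(* Young's inequality with parameter [s]: since (1 + s^-1) s = 1 + s, the top part and its
   complement recombine into (1 + s) |y|^2. *)
apply: (@le_trans _ _ (sig ^+ 2 * ((1 + s) * \sum_(i | i \notin codom iota) e i +
    (1 + s^-1) * nsq t))).
  rewrite (bigID (mem (codom iota))) /= big1 ?add0r; last first.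
    by move=> i /codomP[l ->]; rewrite zero /sqn /= expr0n addr0 mulr0.
  apply: (@le_trans _ _ (sig ^+ 2 * \sum_(i | i \notin codom iota)
      sqn (ip y' (evec (A^t* *m A) i)))).
    rewrite mulr_sumr; apply: ler_sum => i hi.
    by rewrite ler_wpM2r ?sqn_ge0 // sig_le.
  rewrite ler_wpM2l ?sqr_ge0 //.
  apply: (@le_trans _ _ (\sum_(i | i \notin codom iota)
      ((1 + s) * e i + (1 + s^-1) * sqn (ip t (evec (A^t* *m A) i))))).
    by apply: ler_sum => i _; rewrite /y' ipDl ipNl sqn_sub_le.
  rewrite big_split -!mulr_sumr lerD2l ler_wpM2l //.
    by rewrite addr_ge0 ?invr_ge0 ?(ltW s0).
  rewrite nt [leRHS](bigID (mem (codom iota))) /= lerDr.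
  by apply: sumr_ge0 => i _; apply: sqn_ge0.
rewrite ler_wpM2l ?sqr_ge0 //.
apply: (@le_trans _ _ ((1 + s) * nsq y)); last first.
  by rewrite ler_piMr // addr_ge0 ?(ltW s0).
rewrite ny [X in _ <= _ * X](bigID (mem (codom iota))) /= mulrDr addrC lerD2r.
apply: (@le_trans _ _ ((1 + s^-1) * (s * \sum_(i in codom iota) e i))).
  by rewrite ler_wpM2l // addr_ge0 ?invr_ge0 ?(ltW s0).
by rewrite mulrA mulrDl mul1r mulVf ?gt_eqF // addrC.
Qed.

End Frame.
End RangeFinder.

(** * Assembly *)

Section Assembly.
Context {R : realType}.
Local Notation C := R[i].

Lemma sqn_sum_le (I : finType) (A : {set I}) (a : I -> C) :
  sqn (\sum_(k in A) a k) <= #|A|%:R * \sum_(k in A) sqn (a k).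
Proof.
pose x : 'rV[C]_#|I| := \row_k (if enum_val k \in A then a (enum_val k) else 0).
pose y : 'rV[C]_#|I| := \row_k (enum_val k \in A)%:R%:C%C.
have re (V : nmodType) (F : I -> V) : \sum_(k < #|I|) F (enum_val k) = \sum_k F k.
  rewrite [RHS](reindex (@enum_val I predT)) //=.
  by apply: onW_bij; apply: enum_val_bij.
have := cauchy_schwarz x y.
have -> : ip x y = \sum_(k in A) a k.
  rewrite ipE [RHS]big_mkcond -re; apply: eq_bigr => k _.
  by rewrite !mxE conj_real; case: ifP => _; rewrite ?mul0r // rmorph1 mulr1.
have -> : nsq x = \sum_(k in A) sqn (a k).
  rewrite nsqE [RHS]big_mkcond -re; apply: eq_bigr => k _.
  by rewrite mxE; case: ifP => _ //; rewrite /sqn /= expr0n addr0.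
have -> : nsq y = #|A|%:R; last by rewrite mulrC.
rewrite nsqE -sum1_card natr_sum [RHS]big_mkcond -re; apply: eq_bigr => k _.
by rewrite mxE sqn_real; case: ifP => _; rewrite ?expr1n // expr0n.
Qed.

Lemma qf_dim1 r (K : 'M[C]_r) (x y : 'rV[C]_r) :
  r = 1%N -> nsq x = nsq y -> qf K x = qf K y.
Proof.
move=> e; subst r.
have E (z : 'rV[C]_1) : qf K z = nsq z * complex.Re (K 0 0).
  rewrite /qf ipE big_ord1 mxE big_ord1 nsqE big_ord1.
  by case: (z 0 0) (K 0 0) => [a a'] [k k']; rewrite /sqn /=; ring.
by rewrite !E => ->.
Qed.

Section Fixed.
Context (m n r d alpha : nat) (A : 'M[C]_(m, n)) (iota : 'I_r -> 'I_n) (eps M : R).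
Local Notation I := ('I_n * 'I_d)%type.
Local Notation S := {ffun I -> bool}.
Local Notation B := {ffun 'I_n -> {set 'I_d}}.
Local Notation v := (top_vec A iota).
Hypothesis iota_inj : injective iota.
Hypothesis sig_ge0 : 0 <= sigma A r.+1.
Hypothesis sig_le : forall i, i \notin codom iota ->
  ev (A^t* *m A) i <= sigma A r.+1 ^+ 2.
Hypothesis eps_lt1 : eps < 1.
Hypothesis M_gt0 : 0 < M.
Hypothesis alpha_gt0 : (0 < alpha)%N.

Definition good_error (W : 'M[R]_(n, d)) : Prop :=
  spectral_norm ((1%:M - col_proj (A *m map_mx (real_complex R) W)) *m A) <=
  sigma A r.+1 * Num.sqrt (1 + (1 - eps)^-1 * M).

Let a0 : 0 < alpha%:R :> R. Proof. by rewrite ltr0n. Qed.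

Let beta2 : (Num.sqrt alpha%:R)^-1 ^+ 2 = alpha%:R^-1 :> R.
Proof. by rewrite exprVn sqr_sqrtr ?ler0n. Qed.

Lemma sum_sqn_sjlt (b : B) (s : S) x : (forall i, #|b i| = alpha) ->
  \sum_k sqn (\sum_i (sjlt_mx alpha b s i k)%:C%C * ip x (v i)) =
  nsq x + alpha%:R^-1 * chaos b v x s.
Proof.
move=> hb; transitivity (alpha%:R^-1 *
    \sum_k sqn (ip x (rvec (zvec b v) (before n d n) k s))).
  rewrite mulr_sumr; apply: eq_bigr => k _.
  rewrite -beta2 -sqn_real -sqnM; congr sqn.
  rewrite ip_rvec big_before mulr_sumr [RHS]big_mkcond; apply: eq_bigr => i _.
  rewrite ltn_ord mxE /zvec /=; case: ifP => _; last by rewrite ip0r mulr0 mulr0 mul0r.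
  by rewrite mulrA -rmorphM [_ * sg _]mulrC.
rewrite sum_sqn_cols mulrDr; congr (_ + _).
rewrite -(top_frame A iota_inj) mulr_sumr; apply: eq_bigr => i _.
by rewrite hb mulKf // gt_eqF.
Qed.

(** Cauchy-Schwarz on a row with alpha entries of square 1/alpha leaves no factor alpha; summing
    over rows then gives the column counts. *)
Lemma sum_sqn_sjlt_mul (b : B) (s : S) (z : 'rV[C]_d) :
  (forall i, #|b i| = alpha) -> (forall k, (\sum_i (k \in b i))%:R <= M) ->
  \sum_i sqn (\sum_k (sjlt_mx alpha b s i k)%:C%C * z 0 k) <= M * nsq z.
Proof.
move=> hb hM; apply: (@le_trans _ _ (\sum_i \sum_(k in b i) sqn (z 0 k))).
  apply: ler_sum => i _.
  have -> : \sum_k (sjlt_mx alpha b s i k)%:C%C * z 0 k =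
      \sum_(k in b i) (sjlt_mx alpha b s i k)%:C%C * z 0 k.
    rewrite [RHS]big_mkcond; apply: eq_bigr => k _.
    by rewrite mxE; case: ifP => // _; rewrite mul0r.
  apply: le_trans (sqn_sum_le _ _) _; rewrite mulr_sumr ler_sum // => k hk.
  rewrite sqnM sqn_real mxE hk exprMn sg_sqr mul1r beta2 hb mulrA mulfV ?mul1r //.
  by rewrite gt_eqF.
under eq_bigr do rewrite big_mkcond.
rewrite exchange_big nsqE mulr_sumr ler_sum // => k _ /=.
rewrite -big_mkcond /= sumr_const -[leLHS]mulr_natl ler_wpM2r ?sqn_ge0 //.
by apply: le_trans (hM k); rewrite ler_nat -sum1_card big_mkcond leq_sum // => i _; case: ifP.
Qed.

Lemma good_sjlt (b : B) (s : S) :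
  (forall i, #|b i| = alpha) -> (forall k, (\sum_i (k \in b i))%:R <= M) ->
  (forall x, nsq x = 1 -> - (eps * alpha%:R) <= chaos b v x s) ->
  good_error (sjlt_mx alpha b s).
Proof.
move=> hb hM hc; apply: (range_finder_error iota_inj) => // [x x1|z].
  rewrite sum_sqn_sjlt // x1 lerD2l.
  have := hc x x1; rewrite -(ler_pM2l (_ : 0 < alpha%:R^-1 :> R)) ?invr_gt0 //.
  by rewrite mulrN mulrCA mulVf ?mulr1 // gt_eqF.
exact: sum_sqn_sjlt_mul.
Qed.

(** * Success probability in the finite model *)

Section Probability.
Context (c : sjlt_construction) (delta : R).
Hypothesis alpha_le : (alpha <= d)%N.
Hypothesis chunks : c = Block -> (alpha %| d)%N.
Hypothesis r_gt0 : (0 < r)%N.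
Hypothesis delta01 : 0 < delta < 1.
Hypothesis total : sjlt_prob alpha c (@setT 'M[R]_(n, d)) = 1.
Hypothesis M_mean : expR 2 * (n%:R * (alpha%:R / d%:R)) <= M.
Hypothesis M_tail : ln (2 * d%:R / delta) - n%:R * (alpha%:R / d%:R) <= M.
Local Notation q := (row_support_prob c alpha).
Local Notation rho := (alpha%:R / d%:R : R).

Let d_gt0 : 0 < d%:R :> R. Proof. by rewrite ltr0n (leq_trans alpha_gt0). Qed.
Let delta_gt0 : 0 < delta. Proof. by case/andP: delta01. Qed.
Let q0 (b : {set 'I_d}) : 0 <= q b :> R. Proof. exact: row_support_prob_ge0. Qed.
Let rho0 : 0 <= rho. Proof. by rewrite divr_ge0. Qed.
Let qU (U : {set 'I_d}) : \sum_(b : {set 'I_d} | U \subset b) q b <= rho ^+ #|U|.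
Proof. exact: row_support_prob_superset. Qed.
Let qc (b : {set 'I_d}) : q b != 0 :> R -> #|b| = alpha.
Proof. exact: row_support_prob_card. Qed.

Let over (b : B) k : R := (M < (\sum_i (k \in b i))%:R)%R%:R.

Let Epos_cst (a : R) : Epos q (fun _ : B => a) = a.
Proof.
rewrite -[RHS]mulr1 -total /sjlt_prob -EposZ; apply: eq_bigr => b _.
congr (_ * _); rewrite -[LHS]mulr1; congr (_ * _).
rewrite -[LHS](Esg_cst I); apply: eq_Esg => s.
by rewrite asboolT.
Qed.

(** Union bound over the d columns, each with tail delta / (2 d). *)
Let Epos_over : Epos q (fun b => \sum_k over b k) <= delta / 2.
Proof.
rewrite Epos_sum.
have d2 : 0 < 2 * d%:R / delta by rewrite divr_gt0 // mulr_gt0.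
apply: (@le_trans _ _ (\sum_(k < d) (2 * d%:R / delta)^-1)).
  apply: ler_sum => k _.
  rewrite -[(_ / _)^-1]lnK ?posrE ?invr_gt0 // lnV ?posrE //.
  exact: (Epos_col_count_tail q0 qU k M_mean M_tail).
rewrite sumr_const card_ord -[_ *+ d]mulr_natl le_eqVlt; apply/orP; left; apply/eqP.
by field; rewrite !gt_eqF.
Qed.

(** Supports of positive weight have rows of size alpha, so a conditional lower bound on those alone
    can be averaged. *)
Let good_Epos (h : B -> R) :
  (forall b : B, (forall i, #|b i| = alpha) ->
     h b <= Esg (fun s => `[< good_error (sjlt_mx alpha b s) >]%:R)) ->
  Epos q h <= sjlt_prob alpha c good_error.
Proof.
move=> hh; apply: ler_sum => b _.
have [->|ne] := eqVneq (\prod_i q (b i)) (0 : R); first by rewrite !mul0r.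
rewrite ler_wpM2l ?prodr_ge0 // hh // => i; apply: qc.
by move/prodf_neq0: ne => /(_ i isT).
Qed.

Let over_ge0 (b : B) : 0 <= \sum_k over b k.
Proof. by apply: sumr_ge0 => k _. Qed.

Let over_ge1 (b : B) : (exists k, M < (\sum_i (k \in b i))%:R) -> 1 <= \sum_k over b k.
Proof.
move=> [k hk]; rewrite (bigD1 k) //= {1}/over hk lerDl.
by apply: sumr_ge0.
Qed.

Let not_over (b : B) : ~ (exists k, M < (\sum_i (k \in b i))%:R) ->
  forall k, (\sum_i (k \in b i))%:R <= M.
Proof. by move=> h k; rewrite leNgt; apply/negP => hk; apply: h; exists k. Qed.

Lemma prob_good_main lam : 1 <= lam ->
  ln (12 * r%:R / delta) + 1 <= lam ->
  4 * r%:R * (alpha%:R * rho) <= 1 ->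
  201 * lam ^+ 2 <= eps * alpha%:R ->
  1 - delta <= sjlt_prob alpha c good_error.
Proof.
move=> lam1 hlam small heps.
have rp : 0 < r%:R :> R by rewrite ltr0n.
have r1 : 1 <= r%:R :> R by rewrite ler1n.
have P12 : 0 < 12 * r%:R / delta by rewrite divr_gt0 // mulr_gt0.
have fr := top_frame A iota_inj; have d0 := delta_gt0.
pose Psi (b : B) : R := overlap_moment b v.
have Psi_ge1 (b : B) : 1 <= Psi b by apply: le_trans (overlap_moment_ge _ fr).
have EPsi : Epos q Psi <= 3 * r%:R.
  rewrite /Psi /overlap_moment Epos_sum -(frame_sum_nsq fr) mulr_sumr.
  apply: ler_sum => j _; rewrite EposZ mulrC ler_wpM2r ?nsq_ge0 //.
  apply: (Epos_overlap q0 rho0 qU (fun b h => eq_leq (qc h)) j r_gt0) => // [i|].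
    by rewrite nsq_ge0 frame_nsq_le1.
  by rewrite (frame_sum_nsq fr).
(* A lower bound for the success probability given the supports. The budget is delta / 2 for
   overfull columns, delta / 4 for Markov's inequality on [Psi], of mean at most 3 r, and delta / 4
   for the signs. *)
pose h (b : B) : R := 1 - \sum_k over b k - (12 * r%:R / delta)^-1 * Psi b - delta / 4.
apply: (@le_trans _ _ (Epos q h)); last first.
  apply: good_Epos => b hb.
  have E0 : 0 <= Esg (fun s => `[< good_error (sjlt_mx alpha b s) >]%:R : R).
    by apply: Esg_ge0 => s.
  have Ph0 : 0 <= (12 * r%:R / delta)^-1 * Psi b.
    by rewrite mulr_ge0 ?invr_ge0 ?(ltW P12) // (le_trans _ (Psi_ge1 b)).
  have [/over_ge1 ov|/not_over nov] := pselect (exists k, M < (\sum_i (k \in b i))%:R).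
    by apply: le_trans E0; rewrite /h; lra.
  have o0 := over_ge0 b.
  have [le12|gt12] := leP (Psi b) (12 * r%:R / delta); last first.
    apply: le_trans E0; rewrite /h.
    have : 1 <= (12 * r%:R / delta)^-1 * Psi b by rewrite ler_pdivlMl // mulr1 ltW.
    by lra.
  have Psi0 : 0 < Psi b by apply: lt_le_trans (Psi_ge1 b).
  have e12 : 0 < delta / 12 by rewrite divr_gt0.
  have l1 : ln (Psi b) + 1 <= lam.
    by apply: le_trans hlam; rewrite lerD2r ler_ln ?posrE.
  have l2 : ln (Psi b / (delta / 12)) + 1 <= 2 * lam.
    have : ln (Psi b / (delta / 12)) <= ln ((12 * r%:R / delta) * (12 * r%:R / delta)).
      rewrite ler_ln ?posrE ?mulr_gt0 ?invr_gt0 //.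
      apply: ler_pM; rewrite ?invr_ge0 ?(ltW Psi0) ?(ltW e12) //.
      rewrite invf_div ler_pM2r ?invr_gt0 //.
      by rewrite ler_peMr.
    by rewrite [X in _ <= X -> _]lnM ?posrE //; lra.
  have l3 : ln (r%:R / (delta / 12)) <= lam.
    have -> : r%:R / (delta / 12) = 12 * r%:R / delta by field; rewrite gt_eqF.
    by lra.
  have tail := chaos_lower_tail fr r_gt0 lam1 e12 l1 l2 l3.
  apply: (@le_trans _ _ (1 - 3 * (delta / 12))); first by rewrite /h; lra.
  rewrite lerBlDr.
  apply: (@le_trans _ _ (Esg (fun s => `[< good_error (sjlt_mx alpha b s) >]%:R +
     `[< exists2 x, nsq x = 1 & chaos b v x s < - (201 * lam ^+ 2) >]%:R))).
    rewrite -[leLHS](Esg_cst I); apply: Esg_le => s.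
    case: (asboolP (exists2 x, _ & _)) => [_|nx].
      by rewrite lerDr.
    rewrite asboolT ?addr0 //; apply: good_sjlt => // x x1.
    rewrite leNgt; apply/negP => lt; apply: nx; exists x => //.
    by apply: lt_le_trans lt _; rewrite lerN2.
  by rewrite EsgD lerD2l.
have -> : Epos q h = (1 - delta / 4) - Epos q (fun b => \sum_k over b k) -
    (12 * r%:R / delta)^-1 * Epos q Psi.
  rewrite -EposZ -[1 - delta / 4]Epos_cst /Epos -!sumrB; apply: eq_bigr => b _.
  by rewrite /h; ring.
have : (12 * r%:R / delta)^-1 * Epos q Psi <= delta / 4.
  rewrite ler_pdivrMl //; apply: le_trans EPsi _.
  by rewrite le_eqVlt; apply/orP; left; apply/eqP; field; rewrite gt_eqF.
by move: Epos_over; lra.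
Qed.

(* When [delta] is close to 1 the parameters can be too small for any
   concentration, but then only a small success probability is required. *)
Lemma prob_good_rank1 : r = 1%N -> 0 <= eps -> 1 - delta <= 360^-1 ->
  1 - delta <= sjlt_prob alpha c good_error.
Proof.
move=> e1 eps0 hd.
(* In dimension one all unit vectors give the same chaos, so the single vector [x0] suffices. *)
pose x0 : 'rV[C]_r := const_mx 1.
have same (b : B) s x : nsq x = 1 -> chaos b v x s = chaos b v x0 s.
  move=> x1; apply: eq_bigr => p _; congr (_ * _); apply: qf_dim1 => //.
  rewrite x1 nsqE (eq_bigr (fun=> 1)) => [|k _].
    by rewrite sumr_const card_ord e1.
  by rewrite mxE /sqn /= expr1n expr0n addr0.
(* Overfull columns have probability at most delta / 2, so this averages to at least (1 - 1/2) / 180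
   = 1/360, the threshold in the hypothesis. *)
pose h (b : B) : R := 180^-1 * (1 - \sum_k over b k).
apply: (@le_trans _ _ (Epos q h)); last first.
  apply: good_Epos => b hb.
  have E0 : 0 <= Esg (fun s => `[< good_error (sjlt_mx alpha b s) >]%:R : R).
    by apply: Esg_ge0 => s.
  have [/over_ge1 ov|/not_over nov] := pselect (exists k, M < (\sum_i (k \in b i))%:R).
    apply: le_trans E0; rewrite /h pmulr_rle0 ?invr_gt0 //.
    by rewrite subr_le0.
  apply: (@le_trans _ _ 180^-1).
    by rewrite /h -[leRHS]mulr1 ler_wpM2l ?invr_ge0 // gerBl.
  apply: le_trans (chaos_anticoncentration b v x0) _; apply: Esg_le => s.
  have [h0|_] := leP 0 (chaos b v x0 s); last by [].
  rewrite asboolT //; apply: good_sjlt => // x x1.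
  by rewrite same //; apply: le_trans h0; rewrite oppr_le0 mulr_ge0.
rewrite EposZ.
have -> : Epos q (fun b => 1 - \sum_k over b k) =
    1 - Epos q (fun b => \sum_k over b k).
  by rewrite -[X in _ = X - _]Epos_cst /Epos -sumrB; apply: eq_bigr => b _; rewrite mulrBr.
by have := Epos_over; lra.
Qed.

End Probability.
End Fixed.
End Assembly.

(** * Numerical constants and conclusion *)

Section Constants.
Context {R : realType}.

Lemma one_sub_inv_le_ln (x : R) : 0 < x -> 1 - x^-1 <= ln x.
Proof.
move=> x0; have := expR_ge1Dx (ln x^-1).
by rewrite lnK ?posrE ?invr_gt0 // lnV ?posrE // => ?; lra.
Qed.

(** alpha is of order l^3 while l^2 is required; the spare factor a l is at least 1. *)
Lemma constants_alpha (a K l eps al : R) : 0 < a -> a^-1 <= l -> 0 < eps ->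
  a * (201 * K ^+ 2) * (l ^+ 3 / eps) <= al -> 201 * (K * l) ^+ 2 <= eps * al.
Proof.
move=> a0 hl e0; have : 0 < 201%:R :> R by rewrite ltr0n.
move: 201%:R => b b0 h.
have l0 : 0 < l by apply: lt_le_trans hl; rewrite invr_gt0.
apply: (@le_trans _ _ (eps * (a * (b * K ^+ 2) * (l ^+ 3 / eps)))).
  have -> : eps * (a * (b * K ^+ 2) * (l ^+ 3 / eps)) =
      b * (K * l) ^+ 2 * (a * l) by field; rewrite gt_eqF.
  rewrite ler_peMr //; first by rewrite mulr_ge0 ?sqr_ge0 // ltW.
  by rewrite -ler_pdivrMl // mulr1.
by rewrite ler_pM2l.
Qed.

(** alpha^2 is of order l^6 / eps^2, which is the growth required of d / r. *)
Lemma constants_d (C l eps al dd rr : R) : 0 < l -> 0 < eps -> 0 < dd -> 0 <= rr ->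
  0 <= al -> al <= C * (l ^+ 3 / eps) ->
  4 * C ^+ 2 * (rr * l ^+ 6 / eps ^+ 2) <= dd ->
  4 * rr * (al * (al / dd)) <= 1.
Proof.
move=> l0 e0 d0 r0 a0 ha hd.
rewrite !mulrA ler_pdivrMr // mul1r; apply: le_trans hd.
have -> : 4 * C ^+ 2 * (rr * l ^+ 6 / eps ^+ 2) =
    4 * rr * (C * (l ^+ 3 / eps)) ^+ 2 by field; rewrite gt_eqF.
rewrite -mulrA -expr2 ler_wpM2l ?mulr_ge0 //.
by rewrite lerXn2r ?nnegrE // (le_trans a0).
Qed.

End Constants.

Theorem theorem7 (R : realType) :
  exists c1 c2 c3 : R,
    [/\ 0 < c1, c1 <= c2 & 0 < c3] /\
    forall (m n r d alpha : nat) (A : 'M[R[i]]_(m, n)) (eps delta : R)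
      (c : sjlt_construction)
      (disp : measure_display) (T : measurableType disp) (P : probability T R)
      (S : 'I_n -> 'I_d -> {RV P >-> R}),
    (0 < r)%N -> (r < minn m n)%N ->
    0 < eps < 1 -> 0 < delta < 1 ->
    is_SJLT c alpha S ->
    c1 * (ln (r%:R / delta) ^+ 3 / eps) <= alpha%:R ->
    alpha%:R <= c2 * (ln (r%:R / delta) ^+ 3 / eps) ->
    c3 * (r%:R * ln (r%:R / delta) ^+ 6 / eps ^+ 2) <= d%:R ->
    ((1 - delta)%:E <=
     P [set w |
        let Y := A *m map_mx (real_complex R) (random_matrix S w) in
        (spectral_norm ((1%:M - col_proj Y) *m A) <=
         sigma A r.+1 *
         Num.sqrt (1 + (1 - eps)^-1 *
           Num.max (expR 1 ^+ 2 * n%:R * alpha%:R / d%:R)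
                   (ln (2 * d%:R / delta) - n%:R * alpha%:R / d%:R)))%R])%E.
Proof.
(* [a] is the inverse of the threshold in [prob_good_rank1]. [K] makes K l at least 1 and at least
   ln 12 + l + 1, using a l >= 1 and ln 12 <= 11. The existentials keep both constants opaque to the
   arithmetic. *)
have [a aE] : exists a : R, a = 360 by exists 360.
have [K KE] : exists K : R, K = 1 + 12 * a by exists (1 + 12 * a).
have a_gt0 : 0 < a by rewrite aE ltr0n.
have K0 : 0 < K by lra.
pose C1 : R := a * (201 * K ^+ 2).
exists C1, (2 * C1), (4 * (2 * C1) ^+ 2).
have C1_gt0 : 0 < C1 by rewrite !mulr_gt0 ?ltr0n ?exprn_gt0.
split; first by split; [|lra|rewrite mulr_gt0 // exprn_gt0 // mulr_gt0].
move=> m n r d alpha A eps delta c disp T P S r0 rmn /andP[e0 e1] d01 hS h1 h2 h3.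
have /andP[dl0 dl1] := d01.
have rn : (r < n)%N by apply: leq_trans rmn (geq_minr _ _).
have a0 := sjlt_alpha_gt0 hS; have ad := sjlt_alpha_le hS.
have d0 : (0 < d)%N by apply: leq_trans ad.
have n0 : (0 < n)%N by apply: leq_ltn_trans rn.
have [iota iota_inj [sig0 sigle]] := top_indices A rn.
set M := Num.max _ _.
have M1 : expR 2 * (n%:R * (alpha%:R / d%:R)) <= M.
  rewrite le_max; apply/orP; left.
  have -> : expR 2 = expR 1 ^+ 2 :> R by rewrite -expRM_natl mulr1.
  by rewrite !mulrA.
have M2 : ln (2 * d%:R / delta) - n%:R * (alpha%:R / d%:R) <= M.
  by rewrite le_max mulrA lexx orbT.
have M0 : 0 < M.
  by apply: lt_le_trans M1; rewrite !mulr_gt0 ?expR_gt0 ?invr_gt0 ?ltr0n.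
pose G := @good_error R m n r d A eps M.
have total := sjlt_prob_total a0 hS.
suff h : 1 - delta <= sjlt_prob alpha c G.
  by have [_ eG] := law_sjlt a0 hS G; rewrite -lee_fin -eG in h.
have rd0 : 0 < r%:R / delta :> R by rewrite divr_gt0 ?ltr0n.
(* In the first case ln(r / delta) >= 1 - delta / r >= 1/a. In the other, r = 1 and delta is close
   to 1, where anticoncentration suffices. *)
have [hl|hl] := leP a^-1 (1 - delta / r%:R); last first.
  have r1 : r = 1%N.
    apply/eqP; rewrite eqn_leq r0 andbT leqNgt; apply/negP => r2.
    have : delta / r%:R <= 2^-1.
      rewrite ler_pdivrMr ?ltr0n //; have : 2 <= r%:R :> R by rewrite ler_nat.
      by lra.
    have : a^-1 <= 2^-1 by rewrite lef_pV2 ?posrE // aE ler_nat.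
    by lra.
  apply: (prob_good_rank1 (iota := iota)) => //; first exact: sjlt_chunks hS.
    exact: ltW.
  by move: hl; rewrite aE r1 divr1 => /ltW.
set l := ln (r%:R / delta) in h1 h2 h3.
have ll : a^-1 <= l.
  by apply: le_trans hl _; apply: le_trans (one_sub_inv_le_ln rd0); rewrite invf_div.
have l0 : 0 < l by apply: lt_le_trans ll; rewrite invr_gt0.
have al1 : 1 <= a * l by rewrite -ler_pdivrMl // mulr1.
apply: (prob_good_main iota_inj sig0 sigle e1 M0 a0 ad (sjlt_chunks hS) r0 d01 total
  M1 M2 (lam := K * l)).
- by rewrite KE mulrDl -mulrA; lra.
- rewrite -mulrA lnM ?posrE // -/l.
  have : ln 12 <= 11 :> R.
    have := expR_ge1Dx (11 : R); have -> : 1 + 11 = 12 :> R by lra.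
    by move=> h12; rewrite -ler_expR lnK ?posrE.
  by rewrite KE mulrDl -mulrA; lra.
- by apply: (constants_d l0 e0 _ _ _ h2 h3); rewrite ?ltr0n.
- exact: constants_alpha a_gt0 ll e0 h1.
Qed.
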